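(* Let $K$ and $K'$ be number fields, and let $E$ and $E'$ be elliptic curves defined over $K$ and $K'$ respectively. Suppose there exists an isomorphism $\psi: X_K[2] \to X_{K'}[2]$ such that \[ L(E/K, \chi, s) = L(E'/K', \psi(\chi), s) \] for any $\chi \in X_K[2]$. Then there exists a norm-preserving bijection of primes $\phi: \mathcal S \to \mathcal S'$ such that $a_{\mathfrak p} = a'_{\phi(\mathfrak p)}$ for any $\mathfrak p \in \mathcal S$ and \[ \chi(\mathfrak p) = \psi(\chi)(\phi(\mathfrak p)) \] for any $\chi \in X_K[2]$ and $\mathfrak p \in \mathcal S$ such that $a_{\mathfrak p} \neq 0$.
   Context: $X_K[2]$ is the group of quadratic Dirichlet characters of $G_K$; $\chi(\mathfrak p)$ is the Frobenius value if $\chi$ is unramified at $\mathfrak p$, and $0$ otherwise. $S$ is the set of odd rational primes $p$ that are unramified in both $K$ and $K'$ and such that $E$ and $E'$ have good reduction at all primes above $p$; $\mathcal S$ (resp. $\mathcal S'$) is the set of primes of $K$ (resp. $K'$) lying over a prime in $S$. For a prime $\mathfrak p$ of good reduction with inertia degree $f_{\mathfrak p}$ and an unramified quadratic character $\chi$, the local factor is $L_{\mathfrak p}(E/K,\chi,T)=1+\chi(\mathfrak p)a_{\mathfrak p}T^{f_{\mathfrak p}}+p^{f_{\mathfrak p}}T^{2f_{\mathfrak p}}$, which defines $a_{\mathfrak p}$ (and similarly $a'_{\mathfrak q}$ for $E'/K'$); the twisted $L$-series is $L(E/K,\chi,s)=\prod_p\prod_{\mathfrak p\mid p}L_{\mathfrak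 p}(E/K,\chi,p^{-s})^{-1}$. *)

(* Defs.v *)
From HB Require Import structures.
From mathcomp Require Import all_boot all_order all_algebra all_field.
From mathcomp Require Import finmap.
From mathcomp Require Import all_classical all_reals all_analysis.
From mathcomp Require Import complex.
Set Implicit Arguments.
Unset Strict Implicit.
Unset Printing Implicit Defensive.
Import Order.TTheory GRing.Theory Num.Theory.
Import numFieldNormedType.Exports.
Local Open Scope classical_set_scope.
Local Open Scope ring_scope.

(* [A] is meant to be a subring of [F]; the zero ideal is excluded. *)
Definition prime_ideal (F : fieldType) (A P : set F) : Prop :=
  [/\ P `<=` A,
      P 0 /\ (forall x y, P x -> P y -> P (x + y)),
      forall a x, A a -> P x -> P (a * x),
      ~ P 1 /\ (forall a b, A a -> A b -> P (a * b) -> P a \/ P b)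
    & exists2 x, P x & x != 0].

Definition ideal_mul (F : fieldType) (I J : set F) : set F :=
  [set x | exists2 s : seq (F * F),
     forall u, u \in s -> I u.1 /\ J u.2 & x = \sum_(u <- s) u.1 * u.2].

Definition coset_mod (F : fieldType) (A I : set F) (x : F) : set F :=
  [set y | A y /\ I (y - x)].

(* The quotient [A / I], as the set of cosets. *)
Definition quotient_ring (F : fieldType) (A I : set F) : set (set F) :=
  coset_mod A I @` A.

(* 0 when [A] is infinite; only used on finite sets. *)
Definition ncard (T : choiceType) (A : set T) : nat := #|` fset_set A|.

Section NumberField.
Variable K : fieldExtType rat.

Definition integers : set K := [set x | integralOver (intr : int -> K) x].

Definition nf_prime (P : set K) : Prop := prime_ideal integers P.

Definition primes_above (p : nat) : set (set K) :=
  [set P | nf_prime P /\ P p%:R].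

Definition norm_ideal (P : set K) : nat := ncard (quotient_ring integers P).

(* The norm of a prime [P] above [p] is [p ^ f]. *)
Definition inertia_degree (p : nat) (P : set K) : nat := logn p (norm_ideal P).

(* No square of a prime divides [p O_K], i.e. all ramification indices are 1. *)
Definition unramified_in (p : nat) : Prop :=
  forall P, primes_above p P -> ~ ideal_mul P P p%:R.

(* The localization of [O_K] at [P] and its maximal ideal. *)
Definition local_ring (P : set K) : set K :=
  [set x | exists a b,
     [/\ integers a, integers b, ~ P b & x = a / b]].

Definition local_max (P : set K) : set K :=
  [set x | exists a b,
     [/\ P a, integers b, ~ P b & x = a / b]].

End NumberField.

Arguments unramified_in : clear implicits.
Arguments primes_above : clear implicits.

(* y^2 + a1 x y + a3 y = x^3 + a2 x^2 + a4 x + a6 *)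
Record weierstrass (F : fieldType) :=
  Weierstrass { wa1 : F; wa2 : F; wa3 : F; wa4 : F; wa6 : F }.

Section Weierstrass.
Variable F : fieldType.
Implicit Type W : weierstrass F.

Definition wb2 W : F := wa1 W ^+ 2 + 4 * wa2 W.
Definition wb4 W : F := 2 * wa4 W + wa1 W * wa3 W.
Definition wb6 W : F := wa3 W ^+ 2 + 4 * wa6 W.
Definition wb8 W : F :=
  wa1 W ^+ 2 * wa6 W + 4 * wa2 W * wa6 W - wa1 W * wa3 W * wa4 W
  + wa2 W * wa3 W ^+ 2 - wa4 W ^+ 2.

Definition disc W : F :=
  - wb2 W ^+ 2 * wb8 W - 8 * wb4 W ^+ 3 - 27 * wb6 W ^+ 2
  + 9 * wb2 W * wb4 W * wb6 W.

Definition elliptic W : Prop := disc W != 0.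

Definition wpoly W (x y : F) : F :=
  y ^+ 2 + wa1 W * x * y + wa3 W * y
  - (x ^+ 3 + wa2 W * x ^+ 2 + wa4 W * x + wa6 W).

(* The change of variables x = u^2 x' + r, y = u^3 y' + u^2 s x' + t. *)
Definition wchange (u r s t : F) W : weierstrass F :=
  Weierstrass
    ((wa1 W + 2 * s) / u)
    ((wa2 W - s * wa1 W + 3 * r - s ^+ 2) / u ^+ 2)
    ((wa3 W + r * wa1 W + 2 * t) / u ^+ 3)
    ((wa4 W - s * wa3 W + 2 * r * wa2 W - (t + r * s) * wa1 W
      + 3 * r ^+ 2 - 2 * s * t) / u ^+ 4)
    ((wa6 W + r * wa4 W + r ^+ 2 * wa2 W + r ^+ 3 - t * wa3 W
      - t ^+ 2 - r * t * wa1 W) / u ^+ 6).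

Definition model_of W W' : Prop :=
  exists u r s t, u != 0 /\ W' = wchange u r s t W.

(* d y^2 = x^3 + (b2/4) x^2 + (b4/2) x + b6/4, rescaled to be monic. *)
Definition quadratic_twist W (d : F) : weierstrass F :=
  Weierstrass 0 (d * wb2 W / 4) 0 (d ^+ 2 * wb4 W / 2) (d ^+ 3 * wb6 W / 4).

End Weierstrass.

Section Reduction.
Variable K : fieldExtType rat.
Implicit Types (E W : weierstrass K) (P : set K).

Definition integral_at P W : Prop :=
  let O := local_ring P in
  [/\ O (wa1 W), O (wa2 W), O (wa3 W), O (wa4 W) & O (wa6 W)].

(* An integral model whose discriminant divides, in the local ring at [P], the
   discriminant of every other integral model. *)
Definition minimal_at P E W : Prop :=
  [/\ model_of E W, integral_at P W
    & forall W', model_of E W' -> integral_at P W' ->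
        local_ring P (disc W' / disc W)].

Definition good_reduction E P : Prop :=
  exists2 W, minimal_at P E W & ~ local_max P (disc W).

(* Number of points over the residue field of the reduction of a model
   integral at [P]: affine points, plus the point at infinity.  When the
   reduction is singular, the singular point is counted. *)
Definition card_reduction W P : nat :=
  let cl := coset_mod (local_ring P) (local_max P) in
  (ncard [set c : set K * set K | exists x y,
     [/\ local_ring P x, local_ring P y, local_max P (wpoly W x y)
       & c = (cl x, cl y)]]).+1.

(* The number a_P = #E(k_P) - (q + 1), i.e. minus the trace of Frobenius: the
   sign is that of the local factor 1 + a_P T^f + q T^(2f).  The value does not
   depend on the minimal model.  With the singular point counted, a_P is
   -1, 1, 0 for split multiplicative, nonsplit multiplicative and additive
   reduction. *)
Definition ap E P : int :=
  xget 0 [set a : int | exists2 W, minimal_at P E W &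
    a = (card_reduction W P)%:Z - (norm_ideal P).+1%:Z].

(* [p] must be the rational prime below [P]. *)
Definition local_factor E (p : nat) P : {poly int} :=
  let f := inertia_degree p P in
  1 + ap E P *: 'X^f
  + (if `[< good_reduction E P >] then (p ^ f)%:Z *: 'X^(2 * f) else 0).

End Reduction.

(* [algC], an algebraic closure of Q, is an algebraic closure of [K] through
   [iota].  Ring endomorphisms of [algC] are automatically bijective. *)
Record abs_gal (K : fieldExtType rat) (iota : {rmorphism K -> algC}) :=
  AbsGal {
    gal_aut :> {rmorphism algC -> algC};
    gal_fix : forall x : K, gal_aut (iota x) = iota x }.

Section Characters.
Variables (K : fieldExtType rat) (iota : {rmorphism K -> algC}).
Local Notation G := (abs_gal iota).

Lemma gal_comp_subproof (g h : G) (x : K) :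
  ((gal_aut g) \o (gal_aut h)) (iota x) = iota x.
Proof. by rewrite /= !gal_fix. Qed.

Definition gal_comp (g h : G) : G :=
  @AbsGal K iota ((gal_aut g) \o (gal_aut h) : {rmorphism algC -> algC})
    (gal_comp_subproof g h).

(* Continuity for the Krull topology: the kernel contains the stabilizer of
   a finite set. *)
Record quad_char := QuadChar {
  qc_fun :> G -> int;
  qc_mul : forall g h, qc_fun (gal_comp g h) = qc_fun g * qc_fun h;
  qc_sqr : forall g, qc_fun g ^+ 2 = 1;
  qc_cont : exists s : seq algC,
    forall g : G, (forall x, x \in s -> g x = x) -> qc_fun g = 1 }.

Lemma qmul_mul_subproof (c1 c2 : quad_char) (g h : G) :
  c1 (gal_comp g h) * c2 (gal_comp g h) = c1 g * c2 g * (c1 h * c2 h).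
Proof. by rewrite !qc_mul mulrACA. Qed.

Lemma qmul_sqr_subproof (c1 c2 : quad_char) (g : G) : (c1 g * c2 g) ^+ 2 = 1.
Proof. by rewrite exprMn !qc_sqr mulr1. Qed.

Lemma qmul_cont_subproof (c1 c2 : quad_char) : exists s : seq algC,
  forall g : G, (forall x, x \in s -> g x = x) -> c1 g * c2 g = 1.
Proof.
have [s1 h1] := qc_cont c1; have [s2 h2] := qc_cont c2.
exists (s1 ++ s2) => g hg.
by rewrite h1 ?h2 ?mulr1 // => x xs; apply: hg; rewrite mem_cat xs ?orbT.
Qed.

Definition qmul (c1 c2 : quad_char) : quad_char :=
  @QuadChar (fun g => c1 g * c2 g) (qmul_mul_subproof c1 c2)
    (qmul_sqr_subproof c1 c2) (qmul_cont_subproof c1 c2).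

Implicit Types (chi : quad_char) (P : set K) (Q : set algC).

(* The ring of integers of the extension of [K] cut out by [chi], i.e. of the
   fixed field of the kernel of [chi]. *)
Definition char_integers chi : set algC :=
  [set x | x \in Aint /\ forall g : G, chi g = 1 -> g x = x].

Definition char_primes_above chi P : set (set algC) :=
  [set Q | prime_ideal (char_integers chi) Q /\ iota @^-1` Q = P].

Definition in_inertia chi Q (g : G) : Prop :=
  forall x, char_integers chi x -> Q (g x - x).

Definition is_frobenius chi P Q (g : G) : Prop :=
  forall x, char_integers chi x -> Q (g x - x ^+ norm_ideal P).

Definition char_unramified chi P : Prop :=
  forall Q, char_primes_above chi P Q ->
  forall g, in_inertia chi Q g -> chi g = 1.

(* If [chi] is unramified at [P], all the Frobenius elements at the primes
   above [P] have the same value. *)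
Definition char_at chi P : int :=
  if `[< char_unramified chi P >] then
    xget 0 [set a | exists Q g,
      [/\ char_primes_above chi P Q, is_frobenius chi P Q g & a = chi g]]
  else 0.

(* An element [d] (unique up to squares) such that [chi] is the character of
   K(sqrt d) / K. *)
Definition char_radicand chi : K :=
  xget 1 [set d | d != 0 /\ exists2 r : algC,
    r ^+ 2 = iota d & forall g : G, g r = (chi g)%:~R * r].

(* At a prime of good reduction the twisted factor is
   1 + chi(P) a_P T^f + p^f T^(2f) if [chi] is unramified at [P], and 1
   otherwise (inertia has no invariants on V_l(E) (x) chi).  At a bad prime,
   V_l(E) (x) chi = V_l(E^chi) where E^chi is the quadratic twist, so the
   factor is that of E^chi. *)
Definition twisted_local_factor (E : weierstrass K) chi (p : nat) P :
    {poly int} :=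
  let f := inertia_degree p P in
  if `[< good_reduction E P >] then
    1 + (char_at chi P * ap E P) *: 'X^f
    + (char_at chi P ^+ 2 * (p ^ f)%:Z) *: 'X^(2 * f)
  else local_factor (quadratic_twist E (char_radicand chi)) p P.

End Characters.

(* p^(-s) for a complex number s. *)
Definition npow_opp (R : realType) (p : nat) (s : R[i]) : R[i] :=
  let l : R := ln p%:R in
  (expR (- (complex.Re s * l)))%:C%C
  * (cos (complex.Im s * l) -i* sin (complex.Im s * l))%C.

Definition euler_product (R : realType) (K : fieldExtType rat)
    (iota : {rmorphism K -> algC}) (E : weierstrass K) (chi : quad_char iota)
    (s : R[i]) (N : nat) : R[i] :=
  \prod_(p < N | prime p)
    \big[*%R/1]_(P \in primes_above K p)
      ((map_poly intr (twisted_local_factor E chi p P)).[npow_opp p s])^-1.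

Definition Lseries (R : realType) (K : fieldExtType rat)
    (iota : {rmorphism K -> algC}) (E : weierstrass K) (chi : quad_char iota)
    (s : R[i]) : R[i] :=
  lim ((fun N => euler_product E chi s N : R[i]^o) @ \oo).

Section GoodPrimes.
Variables (K K' : fieldExtType rat).
Variables (E : weierstrass K) (E' : weierstrass K').

Definition good_rational_primes : set nat :=
  [set p | [/\ prime p /\ odd p,
              unramified_in K p, unramified_in K' p,
              forall P, primes_above K p P -> good_reduction E P
            & forall P, primes_above K' p P -> good_reduction E' P]].

Definition primes_over (L : fieldExtType rat) (S : set nat) : set (set L) :=
  [set P | exists2 p, S p & primes_above L p P].

End GoodPrimes.

Arguments primes_over : clear implicits.

(* Main.v *)
Require Import Defs.
From HB Require Import structures.
From mathcomp Require Import all_boot all_order all_algebra all_field.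
From mathcomp Require Import finmap.
From mathcomp Require Import all_classical all_reals all_analysis.
From mathcomp Require Import complex.
From mathcomp Require Import ring lra zify.
Import Order.TTheory GRing.Theory Num.Theory.
Import numFieldNormedType.Exports.
Local Open Scope classical_set_scope.
Local Open Scope ring_scope.
Set Implicit Arguments.
Unset Strict Implicit.
Unset Printing Implicit Defensive.

(** The equality of L-series for large integers s forces the equality of the
    Euler factors at every rational prime p, for all quadratic twists.  For p in
    S and P above p, write the factor at P as F_P(chi(P), T) where
    F_P(e, T) = 1 + e a_P T^f + e^2 p^f T^(2f).  Comparing degrees, psi preserves
    the group of characters unramified above p; call eta a variable in it.
    Then log F_P(chi(P) eta(P), T) is the sum of a part independent of eta
    and of eta(P) chi(P) O_P(T), where O_P is the odd part of log F_P in e,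
    which vanishes only if a_P = 0 and determines a_P and f otherwise.  The
    characters eta |-> eta(P) are pairwise distinct and nontrivial, because
    quadratic characters with prescribed signs at the primes above p exist
    (adjoin the square root of a suitable integer); by linear independence of
    characters each P with a_P <> 0 is matched with a unique Q such that
    chi(P) = psi(chi)(Q) for all chi, a_P = a_Q and f_P = f_Q.  Cancelling the
    corresponding factors leaves products of 1 + p^f T^(2f), which determine the
    multiset of the remaining f. *)

(** * The fixed field of the absolute Galois group *)

(** Convergence rests on the crude count |a_P| <= N(P)^2: every local factor, at bad primes too, has
    constant term 1 and coefficients below a fixed power of p, so for large integers s all factors
    are positive reals near 1 and have logarithms. All values [char_at chi P] at odd P come from one
    description: the value is nonzero exactly when [chi] belongs to K(sqrt d) with d in O_K outside
    P, and it is then the sign of d^((N-1)/2) modulo P. A factor depends on e only through e and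
    e^2, and eta(P)^2 = 1 when eta is unramified at P; this is why twisting by eta moves the odd
    part only. Independence of characters is applied at one small real t at a time, with chi fixed
    and possibly ramified; t varies only afterwards, to recover a_P and f. Keeping chi arbitrary
    also gives the equality of values when they are 0. Both fields are treated as families indexed
    over the single group X_K[2], the characters of K' being pulled back through psi. *)

Lemma abs_gal_fixed {K : fieldExtType rat} {iota : {rmorphism K -> algC}} (x : algC) :
  (forall g : abs_gal iota, g x = x) -> exists y, x = iota y.
Proof.
move=> fix_x.
pose b0 := vbasis {:K}.
(* [z] is a primitive element of the field generated by [x] and the image of a basis of K; the
   splitting field [Qr] of its minimal polynomial contains both [x] and iota(K). *)
have [z _ /sig_eqW[[|px ps] // [Dx Ds]]] := algC_PET (x :: map iota b0).
have [p [_ mon_p] /(_ p) pz0] := minCpolyP z; rewrite dvdpp in pz0.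
have [r Dr] := closed_field_poly_normal (map_poly ratr p : {poly algC}).
rewrite lead_coef_map {mon_p}(monicP mon_p) rmorph1 scale1r in Dr.
have{pz0} rz: z \in r by rewrite -root_prod_XsubC -Dr.
have [Qr [QrC [rr Drr genQr]]] := num_field_exists r.
have{rz} [zz Dz]: {zz | QrC zz = z}.
  by move: rz; rewrite -Drr => /mapP/sig2_eqW[zz]; exists zz.
have QrC_poly q : map_poly QrC (map_poly (in_alg Qr) q) = map_poly ratr q.
  rewrite -map_poly_comp; apply: eq_map_poly => a.
  by rewrite /= rmorphZ_num rmorph1 mulr1.
have{Ds} in01P y: {yy | iota y = QrC yy}.
  exists (\sum_i coord b0 i y *: (map_poly (in_alg Qr) ps`_i).[zz]).
  rewrite {1}(coord_vbasis (memvf y)) !rmorph_sum /=; apply: eq_bigr => i _.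
  rewrite 2!rmorphZ_num -(nth_map _ 0) ?size_tuple // Ds.
  rewrite -horner_map Dz QrC_poly (nth_map 0) //.
  by have:= congr1 size Ds; rewrite !size_map size_tuple => <-.
pose in01 y := sval (in01P y).
have Din01 y: iota y = QrC (in01 y) by rewrite /in01; case: (in01P y).
have [xx {}Dx]: exists xx, x = QrC xx.
  exists (map_poly (in_alg Qr) px).[zz].
  by rewrite -horner_map Dz QrC_poly Dx.
pose rwM := (=^~ Din01, rmorphZ_num, rmorph1, rmorphB, rmorphM).
have in01l : linear in01.
  move=> a u v; apply: (fmorph_inj QrC).
  by rewrite !(=^~ Din01, rmorphD, rmorphZ_num).
have in011 : in01 1 = 1 by apply: (fmorph_inj QrC); rewrite !rwM.
have in01M u v : in01 (u * v) = in01 u * in01 v.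
  by apply: (fmorph_inj QrC); rewrite !rwM /= ?rwM.
pose in01L : {linear K -> Qr} := HB.pack in01 (GRing.isLinear.Build _ _ _ _ in01 in01l).
pose lin01 := linfun in01L; pose U := (lin01 @: fullv)%VS.
have memU y: reflect (exists yy, y = in01 yy) (y \in U).
  apply: (iffP memv_imgP) => [[yy _ ->] | [yy ->]];
    by exists yy; rewrite ?lfunE ?memvf.
have algU: is_aspace U.
  rewrite /is_aspace has_algid1; last first.
    by apply/memU; exists 1; rewrite in011.
  apply/prodvP=> _ _ /memU[y1 ->] /memU[y2 ->].
  by apply/memU; exists (y1 * y2); rewrite in01M.
pose pr := map_poly (in_alg Qr) p.
have Qpr: pr \is a polyOver 1%VS.
  by apply/polyOverP=> i; rewrite coef_map memvZ ?memv_line.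
have splitQr: splittingFieldFor 1 pr fullv.
  exists rr => //.
  congr (_ %= _): (eqpxx pr); apply/(map_poly_inj QrC).
  rewrite QrC_poly Dr -Drr big_map rmorph_prod /=; apply: eq_bigr => w _.
  by rewrite map_polyXsubC.
pose L : splittingFieldType rat := HB.pack (FieldExt.sort Qr)
  (FieldExt_isSplittingField.Build rat Qr (ex_intro2 _ _ pr Qpr splitQr)).
pose M : {subfield L} := ASpace algU.
have galM : galois M {:L}.
  apply/and3P; split; first exact: subvf.
    apply/separableP => y _; apply: pcharf0_separable => q.
    by rewrite (pchar_lalg L) pchar_num.
  apply/splitting_normalField; first exact: subvf.
  exists pr; first exact: polyOverSv (sub1v M) _ Qpr.
  exact: splittingFieldForS (sub1v M) (subvf _) splitQr.
have: (xx : L) \in (M : {vspace L}).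
  rewrite -(galois_fixedField galM); apply/fixedFieldP; first exact: memvf.
  move=> a aG.
  (* An automorphism of [Qr] over the image [U] of K extends to [algC] and fixes iota(K), so it
     fixes [x] by hypothesis; Galois theory then puts [x] in [U]. *)
  have [nu Dnu] := @extend_algC_subfield_aut Qr QrC (gal_repr a : {rmorphism L -> L}).
  have nuK (y : K) : nu (iota y) = iota y.
    rewrite Din01 -Dnu; congr (QrC _); apply: (fixed_gal (subvf M) aG).
    by apply/memU; exists y.
  apply: (fmorph_inj QrC); rewrite Dnu -Dx.
  exact: (fix_x (AbsGal nuK)).
by move=> /memU[y yx]; exists y; rewrite Dx yx Din01.
Qed.

(** * Residue fields of rings of integers *)

Lemma ncard_le (T : finType) (U : choiceType) (h : T -> U) (A : set U) :
  A `<=` range h -> (ncard A <= #|T|)%N.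
Proof.
move=> sA; have fT : finite_set [set: T] by exact: finite_finset.
have fR : finite_set (range h) by exact: finite_image.
rewrite /ncard; apply: (@leq_trans #|` fset_set (range h)|).
  by apply: fsubset_leq_card; rewrite -fset_set_sub //; apply: sub_finite_set fR.
rewrite fset_set_image //; apply: leq_trans (leq_imfset_card _ _ _) _.
by rewrite cardE uniq_leq_size ?fset_uniq // => x _; rewrite mem_enum.
Qed.

Lemma ncard_range (T : finType) (U : choiceType) (h : T -> U) :
  injective h -> ncard (range h) = #|T|.
Proof.
move=> ih; have fT : finite_set [set: T] by exact: finite_finset.
rewrite /ncard fset_set_image // card_imfset //=.
rewrite cardE; apply/eqP; rewrite -uniq_size_uniq ?enum_uniq ?fset_uniq //.
by move=> x; rewrite mem_enum in_fset_set // in_setT.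
Qed.

Section RingOfIntegers.
Variable K : fieldExtType rat.
Implicit Types (P : set K) (x y : K) (p : nat).
Local Notation O := (@integers K).
Local Notation intrK := (intr : {rmorphism int -> K}).

Lemma integersB x y : O x -> O y -> O (x - y).
Proof. exact: (@integral_sub _ _ intrK). Qed.
Lemma integersD x y : O x -> O y -> O (x + y).
Proof. exact: (@integral_add _ _ intrK). Qed.
Lemma integersM x y : O x -> O y -> O (x * y).
Proof. exact: (@integral_mul _ _ intrK). Qed.
Lemma integers_int (c : int) : O c%:~R.
Proof. exact: (@integral_id _ _ intrK). Qed.
Lemma integers_nat n : O n%:R. Proof. exact: (@integral_nat _ _ intrK). Qed.
Lemma integers0 : O 0. Proof. exact: (integers_nat 0). Qed.
Lemma integers1 : O 1. Proof. exact: (integers_nat 1). Qed.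
Lemma integersN x : O x -> O (- x).
Proof. by move=> Ox; rewrite -sub0r; apply: integersB => //; exact: integers0. Qed.
Lemma integersX x n : O x -> O (x ^+ n).
Proof.
by move=> Ox; elim: n => [|n IH]; rewrite ?exprS; [exact: integers1|exact: integersM].
Qed.
Lemma integers_sum (I : Type) (r : seq I) (Q : pred I) (F : I -> K) :
  (forall i, Q i -> O (F i)) -> O (\sum_(i <- r | Q i) F i).
Proof.
by move=> OF; elim/big_ind: _ => //; [exact: integers0|exact: integersD].
Qed.

(** A rational dependence is cleared of denominators; storing its coefficients in a polynomial lets
    [zprimitive] divide out their common factor, after which [p] cannot divide them all. *)
Lemma int_relation p (xs : seq K) : prime p -> (\dim {:K} < size xs)%N ->
  exists c : nat -> int, \sum_(i < size xs) (c i)%:~R * xs`_i = 0 /\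
    exists2 i, (i < size xs)%N & ~~ (p %| c i)%Z.
Proof.
move=> p_pr lt_dim.
have : ~ free (in_tuple xs).
  rewrite /free => /eqP fr; have := dimvS (subvf <<xs>>%VS).
  by rewrite fr leqNgt lt_dim.
apply: contra_notP => nrel; apply/freeP => k k0 i0; apply/eqP/negPn/negP => ki0.
apply: nrel; pose q0 := \poly_(i < size xs) oapp k 0 (insub i : option 'I_(size xs)).
have q0E (i : 'I_(size xs)) : q0`_i = k i by rewrite coef_poly ltn_ord valK.
have [q [a a0 Dq]] := rat_poly_scale q0.
have ar0 : (a%:~R : rat) != 0 by rewrite intr_eq0.
have qE i : (q`_i)%:~R = a%:~R * q0`_i :> rat.
  by rewrite Dq coefZ mulrA mulfV // mul1r coef_map.
have qn0 : q != 0.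
  apply/eqP => q_0; have := qE i0; rewrite q_0 coef0 q0E => /esym/eqP.
  by rewrite mulf_eq0 (negPf ar0) (negPf ki0).
have cn0 : zcontents q != 0 by rewrite zcontents_eq0.
exists (fun i => (zprimitive q)`_i); split.
  have cK : ((zcontents q)%:~R : K) != 0.
    by rewrite -(rmorph_int (in_alg K)) fmorph_eq0 intr_eq0.
  apply: (mulfI cK); rewrite mulr0 mulr_sumr.
  transitivity (in_alg K a%:~R * \sum_(i < size xs) k i *: xs`_i); last by rewrite k0 mulr0.
  rewrite mulr_sumr; apply: eq_bigr => i _.
  rewrite mulrA -rmorphM /= -coefZ -zpolyEprim -(rmorph_int (in_alg K)) qE q0E rmorphM -mulrA.
  by rewrite [in_alg K (k i) * _]mulr_algl.
apply: contrapT => nex.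
have : (p %| zcontents (zprimitive q))%Z.
  rewrite dvdz_contents; apply/polyOverP => i.
  have [lt_i|le_i] := ltnP i (size xs).
    by apply/negPn/negP => ndiv; apply: nex; exists i.
  have : q`_i = 0.
    by apply: (@intr_inj rat); rewrite qE coef_poly ltnNge le_i mulr0.
  rewrite {1}[q]zpolyEprim coefZ => /eqP; rewrite mulf_eq0 (negPf cn0) => /eqP ->.
  exact: dvdz0.
rewrite zcontents_primitive qn0 /= dvdz1 absz_nat.
by move=> /eqP p1; rewrite p1 in p_pr.
Qed.

Section PrimeAbove.
Variables (p : nat) (P : set K).
Hypotheses (p_pr : prime p) (PP : primes_above K p P).

Lemma primeI_sub x : P x -> O x. Proof. by case: PP => -[+ _ _ _ _] _; apply. Qed.
Lemma primeI0 : P 0. Proof. by case: PP => -[_ [+ _] _ _ _] _. Qed.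
Lemma primeID x y : P x -> P y -> P (x + y).
Proof. by case: PP => -[_ [_ +] _ _ _] _; apply. Qed.
Lemma primeIM a x : O a -> P x -> P (a * x).
Proof. by case: PP => -[_ _ + _ _] _; apply. Qed.
Lemma primeIN x : P x -> P (- x).
Proof.
by move=> Px; rewrite -mulN1r; apply: primeIM => //; apply: integersN; exact: integers1.
Qed.
Lemma primeIB x y : P x -> P y -> P (x - y).
Proof. by move=> Px /primeIN; exact: primeID. Qed.
Lemma primeI1 : ~ P 1. Proof. by case: PP => -[_ _ _ [+ _] _] _. Qed.
Lemma primeI_or a b : O a -> O b -> P (a * b) -> P a \/ P b.
Proof. by case: PP => -[_ _ _ [_ +] _] _; apply. Qed.
Lemma primeIp : P p%:R. Proof. by case: PP. Qed.

Lemma primeI_subC x y : P (x - y) -> P (y - x).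
Proof. by move/primeIN; rewrite opprB. Qed.
Lemma primeI_trans y x z : P (x - y) -> P (y - z) -> P (x - z).
Proof. by move=> /primeID /[apply]; rewrite addrA subrK. Qed.

Lemma primeI_int (c : int) : P c%:~R <-> (p %| c)%Z.
Proof.
split=> [Pc|/dvdzP[k ->]]; last first.
  by rewrite rmorphM; apply: primeIM; [exact: integers_int|exact: primeIp].
apply/negPn/negP => ndiv; apply: primeI1.
have cop : gcdz p c = 1.
  by apply/eqP; rewrite -[_ == _]/(coprimez p c) /coprimez /gcdz eqz_nat -/(coprime _ _)
    absz_nat prime_coprime.
have [u [v uv]] := Bezoutz p c.
rewrite -[1]/(1%:~R) -cop -uv rmorphD !rmorphM; apply: primeID.
  by apply: primeIM; [exact: integers_int|exact: primeIp].
by apply: primeIM => //; exact: integers_int.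
Qed.

Let indep (xs : seq K) := forall c : nat -> int,
  P (\sum_(i < size xs) (c i)%:~R * xs`_i) ->
  forall i, (i < size xs)%N -> (p %| c i)%Z.

(* A primitive integer relation stays nontrivial modulo p, so O_K / P has dimension
   at most [K : Q] over F_p. *)
Lemma primeI_basis : exists xs : seq K, [/\ forall x, x \in xs -> O x, indep xs,
  (size xs <= \dim {:K})%N
  & forall x, O x -> exists c : nat -> int, P (x - \sum_(i < size xs) (c i)%:~R * xs`_i)].
Proof.
have bnd xs : indep xs -> (size xs <= \dim {:K})%N.
  move=> ind; rewrite leqNgt; apply/negP => /(int_relation p_pr)[c [c0 [i lti]]].
  by rewrite ind // c0; exact: primeI0.
pose Q := fun m => `[< exists xs, [/\ size xs = m, forall x, x \in xs -> O x & indep xs] >].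
have Q0 : exists m, Q m by exists 0%N; apply/asboolP; exists [::].
have Qb m : Q m -> (m <= \dim {:K})%N by move=> /asboolP[xs [<- _ /bnd]].
case: (ex_maxnP Q0 Qb) => m /asboolP[xs [szm Oxs ind]] mmax.
exists xs; split=> //; first exact: bnd.
move=> x Ox.
have : ~ indep (x :: xs).
  move=> ind'; suff /mmax : Q m.+1 by rewrite ltnn.
  apply/asboolP; exists (x :: xs); split=> //=; first by rewrite szm.
  by move=> y; rewrite inE => /orP[/eqP->//|/Oxs].
move=> /existsNP[c /not_implyP[]]; rewrite big_ord_recl /= => Pc.
move=> /existsNP[i /not_implyP[lti ndiv]].
have ndiv0 : ~~ (p %| c 0%N)%Z.
  apply/negP => div0; apply: ndiv; case: i lti => //= i lti.
  apply: (ind (fun i => c i.+1)) => //.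
  have /primeIN/(primeID Pc) : P ((c 0%N)%:~R * x).
    by rewrite mulrC; apply: primeIM => //; apply/primeI_int.
  by rewrite addrAC subrr add0r.
have cop : gcdz p (c 0%N) = 1.
  by apply/eqP; rewrite /gcdz eqz_nat -/(coprime _ _) absz_nat prime_coprime.
have [u [v uv]] := Bezoutz p (c 0%N); rewrite cop in uv.
(* Since u p + v c_0 = 1 and p lies in P, [v] inverts the coefficient of [x] modulo P and the
   relation can be solved for [x]. *)
exists (fun i => - (v * c i.+1)).
have -> : x - \sum_(i0 < size xs) (- (v * c i0.+1))%:~R * xs`_i0 =
   (u%:~R * x) * p%:R + v%:~R * ((c 0%N)%:~R * x + \sum_(i < size xs) (c (bump 0 i))%:~R * xs`_i).
  rewrite mulrDr addrA; congr (_ + _).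
    rewrite mulrAC mulrA -mulrDl -[p%:R]/((p%:Z)%:~R) -!rmorphM -rmorphD /= uv.
    by rewrite mul1r.
  rewrite mulr_sumr -sumrN; apply: eq_bigr => j _.
  by rewrite rmorphN mulNr opprK rmorphM -mulrA.
apply: primeID; apply: primeIM; rewrite ?primeIp //; try exact: integers_int.
  by apply: integersM => //; exact: integers_int.
exact: primeIp.
Qed.

(** Coordinates along a basis modulo P, reduced to digits in ['I_p], give unique representatives, so
    the residue classes form a concrete finite type of cardinal p^f. *)
Lemma residue_finite : exists (f : nat) (T : finType) (rep : T -> K) (cls : K -> T),
  [/\ (f <= \dim {:K})%N, #|T| = (p ^ f)%N, forall t, O (rep t),
      forall x, O x -> P (x - rep (cls x))
    & forall s t, P (rep s - rep t) -> s = t].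
Proof.
have [xs [Oxs ind bnd span]] := primeI_basis.
have p_gt0 := prime_gt0 p_pr.
have pz_gt0 : 0 < p%:Z by rewrite ltz_nat.
have pz_neq0 : p%:Z != 0 by rewrite gt_eqF.
pose T := {ffun 'I_(size xs) -> 'I_p}.
pose rep (t : T) : K := \sum_(i < size xs) (t i : nat)%:R * xs`_i.
have Orep t : O (rep t).
  apply: integers_sum => i _; apply: integersM; first exact: integers_nat.
  by apply: Oxs; rewrite mem_nth.
have clsP x : exists t, O x -> P (x - rep t).
  have [Ox|nOx] := pselect (O x); last by exists [ffun=> Ordinal p_gt0].
  have [c Pc] := span x Ox.
  have lt_p (i : nat) : (`|(c i %% p)%Z| < p)%N.
    by rewrite -ltz_nat gez0_abs ?modz_ge0 ?ltz_pmod.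
  exists [ffun i => Ordinal (lt_p (i : 'I_(size xs)))] => _.
  apply: primeI_trans Pc _; rewrite /rep -sumrB.
  elim/big_ind: _ => [||i _]; [exact: primeI0|exact: primeID|].
  rewrite ffunE /= -mulrBl mulrC; apply: primeIM; first by apply: Oxs; rewrite mem_nth.
  rewrite -[_%:R]/((`|(c i %% p)%Z|%N%:Z)%:~R) -rmorphB; apply/primeI_int.
  rewrite gez0_abs ?modz_ge0 //.
  by rewrite {1}(divz_eq (c i) p) addrK dvdz_mull.
have [cls clsE] := choice clsP.
exists (size xs), T, rep, cls; split=> //; first by rewrite card_ffun !card_ord.
move=> s t; rewrite /rep -sumrB => Pst; apply/ffunP => i; apply/val_inj => /=.
pose c (j : nat) : int := oapp (fun j => (s j : nat)%:Z - (t j : nat)%:Z) 0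
   (insub j : option 'I_(size xs)).
have : (p %| c i)%Z.
  apply: ind (ltn_ord i); congr P: Pst; apply: eq_bigr => j _.
  by rewrite /c valK /= rmorphB mulrBl.
rewrite /c valK /= -eqz_mod_dvd !modz_nat eqz_nat !modn_small //.
by move/eqP.
Qed.

(** The ring structure of O_K / P is transported to the finite type of representatives, which gives
    access to root counting and Fermat's theorem in a [finFieldType]. [pi] is total on K but
    constrained only on O_K. *)
Lemma residue_field : exists (F : finFieldType) (pi : K -> F) (rep : F -> K),
  [/\ #|F| = norm_ideal P, exists2 f, (0 < f <= \dim {:K})%N & norm_ideal P = (p ^ f)%N,
      {in O &, {morph pi : x y / x * y}} /\ {in O &, {morph pi : x y / x - y}},
      forall x, O x -> (pi x = 0 <-> P x)
    & pi 1 = 1 /\ (forall t, O (rep t) /\ pi (rep t) = t)].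
Proof.
have [f [T [rep [cls [lef cardT Orep clsE rep_inj]]]]] := residue_finite.
have repK t : cls (rep t) = t.
  by apply/esym/rep_inj/clsE.
have cls_eq x y : O x -> O y -> (cls x = cls y <-> P (x - y)).
  move=> Ox Oy; split=> [eq_xy|Pxy].
    apply: primeI_trans (clsE _ Ox) _; rewrite eq_xy; exact/primeI_subC/clsE.
  apply: rep_inj; apply: primeI_trans (primeI_subC (clsE _ Ox)) _.
  exact: primeI_trans Pxy (clsE _ Oy).
pose zero := cls 0; pose one := cls 1; pose opp t := cls (- rep t).
pose add s t := cls (rep s + rep t); pose mul s t := cls (rep s * rep t).
have clsD x y : O x -> O y -> add (cls x) (cls y) = cls (x + y).
  move=> Ox Oy; apply/cls_eq; try exact: integersD.
  rewrite opprD addrACA; apply: primeID; exact/primeI_subC/clsE.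
have clsN x : O x -> opp (cls x) = cls (- x).
  move=> Ox; apply/cls_eq; try exact: integersN.
  by rewrite opprK addrC; exact: clsE.
have clsM x y : O x -> O y -> mul (cls x) (cls y) = cls (x * y).
  move=> Ox Oy; apply/cls_eq; try exact: integersM.
  have -> : rep (cls x) * rep (cls y) - x * y =
     rep (cls x) * (rep (cls y) - y) + y * (rep (cls x) - x) by ring.
  by apply: primeID; apply: primeIM => //; exact/primeI_subC/clsE.
have OD := integersD; have OM := integersM; have ON := integersN.
have O0 := integers0; have O1 := integers1.
have addA : associative add.
  by move=> r s t; rewrite -[r]repK -[s]repK -[t]repK !clsD ?addrA //; apply: OD.
have addC : commutative add.
  by move=> s t; rewrite -[s]repK -[t]repK !clsD // addrC.
have add0 : left_id zero add.
  by move=> s; rewrite -[s]repK !clsD ?add0r //.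
have addN : left_inverse zero opp add.
  by move=> s; rewrite -[s]repK clsN // clsD ?addNr //; apply: ON.
have mulA : associative mul.
  by move=> r s t; rewrite -[r]repK -[s]repK -[t]repK !clsM ?mulrA //; apply: OM.
have mulC : commutative mul.
  by move=> s t; rewrite -[s]repK -[t]repK !clsM // mulrC.
have mul1 : left_id one mul.
  by move=> s; rewrite -[s]repK !clsM ?mul1r //.
have mulD : left_distributive mul add.
  move=> r s t; rewrite -[r]repK -[s]repK -[t]repK !(clsM, clsD) ?mulrDl //;
  by [apply: OM|apply: OD].
have one0 : one != zero.
  by apply/eqP => /cls_eq -/(_ O1 O0); rewrite subr0; exact: primeI1.
pose Z : finZmodType := HB.pack (Finite.sort T)
  (GRing.isZmodule.Build T addA addC add0 addN).
pose R : finComNzRingType := HB.pack (FinRing.Zmodule.sort Z)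
  (GRing.Zmodule_isComNzRing.Build Z mulA mulC mul1 mulD one0).
have addE (s t : R) : s + t = add s t by [].
have mulE (s t : R) : s * t = mul s t by [].
have zE (x : K) : O x -> ((cls x : R) = 0 <-> P x).
  by move=> Ox; have := cls_eq _ _ Ox O0; rewrite subr0.
(* Multiplication by a nonzero [s] is injective because P is prime, hence bijective on a finite
   set. *)
have inv_ex (s : R) : exists t : R, (s != 0 -> t * s = 1) /\ (s = 0 -> t = 0).
  have [->|sn0] := eqVneq s 0; first by exists 0.
  have inj : injective (fun t : R => t * s).
    move=> t1 t2 /eqP; rewrite -subr_eq0 -mulrBl => /eqP.
    move: (erefl (t1 - t2)); move: {-1}(t1 - t2) => u Du.
    rewrite -[u]repK -[s]repK mulE clsM // => /zE -/(_ (OM _ _ (Orep _) (Orep _))).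
    move=> /(primeI_or (Orep _) (Orep _))[/zE -/(_ (Orep _))|/zE -/(_ (Orep _))]; rewrite repK.
      by rewrite -Du => /eqP; rewrite subr_eq0 => /eqP.
    by move=> s0; rewrite s0 eqxx in sn0.
  have [g _ gK] := injF_bij inj; exists (g 1); split=> [_|s0]; first exact: gK.
  by rewrite s0 eqxx in sn0.
have [inv invP] := choice inv_ex.
pose F : finFieldType := HB.pack (FinRing.ComNzRing.sort R)
  (GRing.ComNzRing_isField.Build R (fun s => (invP s).1) ((invP 0).2 erefl)).
have cardN : norm_ideal P = #|T|.
  rewrite /norm_ideal /quotient_ring.
  have -> : [set coset_mod O P x | x in O] = range (fun t => coset_mod O P (rep t)).
    apply/seteqP; split=> [_ [x Ox <-]|_ [t _ <-]]; last by exists (rep t).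
    exists (cls x) => //; apply/seteqP; split=> y [Oy Py]; split=> //.
      exact: primeI_trans Py (primeI_subC (clsE _ Ox)).
    exact: primeI_trans Py (clsE _ Ox).
  apply: ncard_range => s t st; apply: rep_inj.
  have : coset_mod O P (rep s) (rep s) by split=> //; rewrite subrr; exact: primeI0.
  by rewrite st => -[].
exists F, (cls : K -> F), (rep : F -> K); split=> //.
- by rewrite cardN; apply: (@bij_eq_card F T id); exists id.
- exists f; last by rewrite cardN.
  rewrite lef andbT lt0n; apply/eqP => f0; have := one0.
  have /fintype_le1P/(_ zero one) -> : (#|T| <= 1)%N by rewrite cardT f0.
  by rewrite eqxx.
- split=> x y; rewrite !inE => Ox Oy; first by rewrite -clsM.
  have subE (u v : F) : u - v = add u (opp v) by [].
  by rewrite subE clsN // clsD //; exact: ON.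
Qed.

End PrimeAbove.
End RingOfIntegers.

Section PrimeConsequences.
Variables (K : fieldExtType rat) (p : nat) (P : set K).
Hypotheses (p_pr : prime p) (PP : primes_above K p P).
Local Notation O := (@integers K).
Local Notation N := (norm_ideal P).

Lemma norm_ideal_expE :
  (0 < inertia_degree p P <= \dim {:K})%N /\ N = (p ^ inertia_degree p P)%N.
Proof.
have [F [pi [rep [_ [f f_bnd Nf] _ _ _]]]] := residue_field p_pr PP.
by rewrite /inertia_degree Nf pfactorK.
Qed.

Lemma norm_ideal_gt1 : (1 < N)%N.
Proof.
have [/andP[f0 _] ->] := norm_ideal_expE.
by rewrite -{1}(exp1n (inertia_degree p P)) ltn_exp2r // prime_gt1.
Qed.

Lemma primeI_inv x : O x -> ~ P x -> exists2 y, O y & P (x * y - 1).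
Proof.
have [F [pi [rep [_ _ [piM piB] pi0 [pi1 repP]]]]] := residue_field p_pr PP.
move=> Ox nPx; have [Oy py] := repP (pi x)^-1; exists (rep (pi x)^-1) => //.
have Oxy := integersM Ox Oy; have O1 := @integers1 K.
apply/(pi0 _ (integersB Oxy O1)); rewrite piB ?inE // piM ?inE // py pi1 mulfV ?subrr //.
by apply/eqP => /pi0 -/(_ Ox).
Qed.

Lemma fermat_primeI x : O x -> P (x ^+ N - x).
Proof.
have [F [pi [rep [cN _ [piM piB] pi0 [pi1 repP]]]]] := residue_field p_pr PP.
move=> Ox; have piX n : pi (x ^+ n) = pi x ^+ n.
  by elim: n => [//|n IH]; rewrite !exprS piM ?inE ?IH //; exact: integersX.
have OxN := integersX N Ox.
apply/(pi0 _ (integersB OxN Ox)).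
by rewrite piB ?inE // piX -cN expf_card subrr.
Qed.

Lemma primeI_expM x : O x -> ~ P x -> P (x ^+ N.-1 - 1).
Proof.
move=> Ox nPx; have := fermat_primeI Ox.
have O1 := @integers1 K; have OxN := integersX N.-1 Ox.
rewrite -{1}(prednK (ltnW norm_ideal_gt1)) exprS -{3}[x]mulr1 -mulrBr.
by move=> /(primeI_or PP Ox (integersB OxN O1))[].
Qed.

Lemma norm_ideal_odd : odd p -> N = ((N.-1./2).*2).+1.
Proof.
move=> p_odd; have oddN : odd N by rewrite (norm_ideal_expE).2 oddX p_odd orbT.
have N0 := ltnW norm_ideal_gt1.
rewrite -{1}(prednK N0) -[in LHS](odd_double_half N.-1).
by rewrite (_ : odd N.-1 = false) // -[odd _]negbK -/(odd N.-1.+1) prednK // oddN.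
Qed.

Lemma primeI2 : odd p -> ~ P 2.
Proof.
move=> p_odd /(primeI_int p_pr PP 2); rewrite dvdzE /= => /prime_nt_dvdP.
by move=> /(_ isT) -/(_ _); case: (p =P 1%N) p_pr p_odd => [->//|_] _ + /(_ isT) e; rewrite e.
Qed.

(** The nonzero residues number 2m with m = (N-1)/2, too many to be all roots of X^m - 1. *)
Lemma nonresidue_exists : odd p ->
  exists d, [/\ O d, ~ P d & ~ P (d ^+ (N.-1)./2 - 1)].
Proof.
move=> p_odd.
have [F [pi [rep [cN _ [piM piB] pi0 [pi1 repP]]]]] := residue_field p_pr PP.
have piX x n : O x -> pi (x ^+ n) = pi x ^+ n.
  move=> Ox; elim: n => [//|n IH]; rewrite !exprS piM ?inE ?IH //; exact: integersX.
pose m := (N.-1./2)%N.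
have m0 : (0 < m)%N.
  by have := norm_ideal_gt1; rewrite {1}(norm_ideal_odd p_odd) -/m; case: m.
have [t [t0 tm]] : exists t : F, t != 0 /\ t ^+ m != 1.
  apply: contrapT => allroot.
  pose s := [seq t <- enum F | t != 0].
  have us : uniq s by rewrite filter_uniq // enum_uniq.
  have rs : all (root ('X^m - 1)) s.
    apply/allP => t; rewrite mem_filter => /andP[t0 _].
    rewrite rootE !hornerE subr_eq0; apply/negPn/negP => tm.
    by apply: allroot; exists t.
  have := max_poly_roots (monic_neq0 (monic_Xn_sub_1 _ m0)) rs us.
  rewrite size_XnsubC // ltnS size_filter.
  have := count_predC (fun t : F => t != 0) (enum F).
  rewrite -cardE cN (@eq_count _ (predC (fun t : F => t != 0)) (pred1 0)); last by move=> t /=; rewrite negbK.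
  rewrite count_uniq_mem ?enum_uniq // mem_enum /= {1}(norm_ideal_odd p_odd) -/m addn1.
  by move=> -[->]; rewrite -addnn -{3}[m]addn0 leq_add2l leqNgt m0.
have [Od pd] := repP t; exists (rep t); split=> //.
  by move/pi0 => /(_ Od) e; rewrite -pd e eqxx in t0.
have Odm := integersX m Od; have O1 := @integers1 K.
move=> /(pi0 _ (integersB Odm O1)); rewrite piB ?inE // piX // pd pi1.
by move/eqP; rewrite subr_eq0 (negPf tm).
Qed.

(** Denominators prime to P are invertible modulo P, so every class of the localization has one of
    the N representatives in O_K. *)
Lemma card_reduction_le (W : weierstrass K) : (card_reduction W P <= (N ^ 2).+1)%N.
Proof.
have [F [pi [rep [cN _ [piM piB] pi0 [pi1 repP]]]]] := residue_field p_pr PP.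
rewrite /card_reduction ltnS -cN -mulnn -card_prod.
set cl := coset_mod _ _.
have lmB x y : local_max P x -> local_max P y -> local_max P (x - y).
  move=> [a [b [Pa Ob nb ->]]] [c [d [Pc Od nd ->]]]; exists (a * d - b * c), (b * d).
  have b0 : b != 0 by apply: contra_notN nb => /eqP->; exact: primeI0 PP.
  have d0 : d != 0 by apply: contra_notN nd => /eqP->; exact: primeI0 PP.
  split; [|exact: integersM| |by field; rewrite ?b0 ?d0].
    by apply: (primeIB PP); [rewrite mulrC|]; apply: (primeIM PP).
  by move=> /(primeI_or PP Ob Od)[].
have cl_eq x y : local_max P (x - y) -> cl x = cl y.
  move=> xy; apply/seteqP; split=> z [Oz Pz]; split=> //.
    rewrite (_ : z - y = (z - x) - ((y - y) - (x - y))); last by ring.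
    have yy : local_max P (y - y) by rewrite subrr -(subrr (x - y)); exact (lmB _ _ xy xy).
    exact (lmB _ _ Pz (lmB _ _ yy xy)).
  by rewrite (_ : z - x = (z - y) - (x - y)); [apply: lmB|ring].
have clP x : local_ring P x -> exists t, cl x = cl (rep t).
  move=> [a [b [Oa Ob nb ->]]]; have [c Oc bc] := primeI_inv Ob nb.
  have b0 : b != 0 by apply: contra_notN nb => /eqP->; exact: primeI0 PP.
  have Oac := integersM Oa Oc.
  exists (pi (a * c)); have [Or pr] := repP (pi (a * c)).
  apply: cl_eq; exists (a - b * rep (pi (a * c))), b; split=> //; last by field.
  rewrite (_ : a - _ = b * (a * c - rep (pi (a * c))) + a * - (b * c - 1)); last by ring.
  apply: (primeID PP); apply: (primeIM PP) => //; last exact: (primeIN PP).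
  by apply/(pi0 _ (integersB Oac Or)); rewrite piB ?inE // pr subrr.
apply: (@ncard_le _ _ (fun t : F * F => (cl (rep t.1), cl (rep t.2)))).
move=> _ [x [y [/clP[t ->] /clP[t' ->] _ ->]]]; by exists (t, t').
Qed.

(** The trivial point count: a bound by a power of N makes the Euler products converge for large
    s. *)
Lemma ap_le (W : weierstrass K) : `|ap W P| <= (N ^ 2)%:Z.
Proof.
rewrite /ap; case: xgetP => [a _ [V _ ->]|_]; last by rewrite normr0.
have := card_reduction_le V; have : (0 < card_reduction V P)%N by [].
have := norm_ideal_gt1; set c := card_reduction V P; set n := N.
rewrite -mulnn; move=> n1 c0 cn; nia.
Qed.

End PrimeConsequences.

(** * Separation, finiteness and Chinese remainders for the primes above p *)

Section ManyPrimes.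
Variables (K : fieldExtType rat) (p : nat).
Hypotheses (p_pr : prime p).
Local Notation O := (@integers K).

Lemma primes_above_maximal P Q : primes_above K p P -> primes_above K p Q ->
  P `<=` Q -> P = Q.
Proof.
move=> PP PQ sPQ; apply/seteqP; split=> // a Qa; apply: contrapT => nPa.
have [b Ob Pab] := primeI_inv p_pr PP (primeI_sub PQ Qa) nPa.
apply: (primeI1 PQ); rewrite (_ : 1 = b * a - (a * b - 1)); last by ring.
by apply: (primeIB PQ); [exact: (primeIM PQ)|exact: sPQ].
Qed.

Lemma primes_above_separate P (s : seq (set K)) : primes_above K p P ->
  (forall Q, Q \in s -> primes_above K p Q /\ Q <> P) ->
  exists e, [/\ O e, ~ P e & forall Q, Q \in s -> Q e].
Proof.
move=> PP; elim: s => [|Q s IH] sP.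
  by exists 1; split=> //; [exact: integers1|exact: (primeI1 PP)].
have [|e [Oe nPe se]] := IH; first by move=> R Rs; apply: sP; rewrite inE Rs orbT.
have [PQ QnP] := sP Q (mem_head _ _).
have [x Qx nPx] : exists2 x, Q x & ~ P x.
  apply: contrapT => nex; apply: QnP; apply: primes_above_maximal => // x Qx.
  by apply: contrapT => nPx; apply: nex; exists x.
have Ox := primeI_sub PQ Qx.
exists (x * e); split; first exact: integersM.
  by move=> /(primeI_or PP Ox Oe)[].
move=> R; rewrite inE => /orP[/eqP->|Rs].
  by rewrite mulrC; apply: (primeIM PQ).
by apply: (primeIM (sP R _).1); rewrite ?inE ?Rs ?orbT //; exact: se.
Qed.

(** Choose [e Q] outside Q but in all the other primes of [s]. More than [K : Q] such elements
    satisfy an integer relation nontrivial modulo p; modulo a Q whose coefficient is prime to p, a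
    single nonzero term survives. *)
Lemma size_primes_above (s : seq (set K)) : uniq s ->
  (forall Q, Q \in s -> primes_above K p Q) -> (size s <= \dim {:K})%N.
Proof.
move=> us sP; rewrite leqNgt; apply/negP => lt_s.
have exe (Q : set K) : exists e, Q \in s ->
    [/\ O e, ~ Q e & forall R, R \in rem Q s -> R e].
  have [Qs|nQs] := boolP (Q \in s); last by exists 0.
  have [|e eP] := @primes_above_separate Q (rem Q s) (sP _ Qs); last by exists e.
  by move=> R; rewrite mem_rem_uniq // inE => /andP[/eqP RQ /sP].
have [e eP] := choice exe.
have [|c [c0 [i lti ndiv]]] := @int_relation K p (map e s) p_pr; first by rewrite size_map.
rewrite size_map in c0 lti.
pose Q := nth set0 s i; have Qs : Q \in s by rewrite mem_nth.
have PQ := sP _ Qs; have [Oe nQe _] := eP _ Qs.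
have : Q ((c i)%:~R * e Q).
  move/eqP: c0; rewrite (bigD1 (Ordinal lti)) //= addr_eq0 (nth_map set0) // => /eqP ->.
  apply: (primeIN PQ); elim/big_ind: _ => [||j ji]; [exact: (primeI0 PQ)|exact: (primeID PQ)|].
  apply: (primeIM PQ); first exact: integers_int.
  rewrite (nth_map set0) //; have [_ _] := eP _ (mem_nth set0 (ltn_ord j)); apply.
  rewrite mem_rem_uniq // inE Qs andbT nth_uniq // eq_sym.
  by apply: contraNneq ji => e_ji; apply/eqP/val_inj.
move=> /(primeI_or PQ (integers_int K (c i)) Oe)[/(primeI_int p_pr PQ)|//].
by rewrite (negPf ndiv).
Qed.

Lemma finite_primes_above : finite_set (primes_above K p).
Proof.
apply: contrapT => /(infinite_set_fset (\dim {:K}).+1)[B sB].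
by rewrite leqNgt ltnS size_primes_above ?fset_uniq // => Q QB; apply: sB.
Qed.

Lemma nonresidue_crt P : odd p -> primes_above K p P ->
  exists d, [/\ O d, forall Q, primes_above K p Q -> ~ Q d,
     ~ P (d ^+ ((norm_ideal P).-1)./2 - 1)
   & forall Q, primes_above K p Q -> Q <> P -> Q (d - 1)].
Proof.
move=> p_odd PP; have [d0 [Od0 nPd0 nonres]] := nonresidue_exists p_pr PP p_odd.
have finA := finite_primes_above.
have [|e [Oe nPe eP]] := @primes_above_separate P
    [seq Q <- fset_set (primes_above K p) | Q != P] PP.
  by move=> Q; rewrite mem_filter in_fset_set // => /andP[/eqP QP /set_mem].
have [b Ob Peb] := primeI_inv p_pr PP Oe nPe.
have O1 := @integers1 K.
have Oeb := integersM Oe Ob.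
(* [e * b] is 1 modulo P and 0 modulo the other primes above p. *)
pose d := 1 + e * b * (d0 - 1).
have Od : O d by apply: integersD => //; apply: integersM => //; exact: integersB.
have Pd : P (d - d0).
  rewrite (_ : d - d0 = (d0 - 1) * (e * b - 1)); last by rewrite /d; ring.
  by apply: (primeIM PP) => //; exact: integersB.
have Qd Q : primes_above K p Q -> Q <> P -> Q (d - 1).
  move=> PQ /eqP QP; rewrite /d addrAC subrr add0r.
  rewrite (_ : e * b * _ = (b * (d0 - 1)) * e); last by ring.
  apply: (primeIM PQ); first by apply: integersM => //; exact: integersB.
  by apply: eP; rewrite mem_filter QP in_fset_set //=; exact: mem_set.
exists d; split=> //.
  move=> Q PQ Qdd; have [QP|QP] := eqVneq Q P.
    subst Q; apply: nPd0; rewrite (_ : d0 = d - (d - d0)); last by ring.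
    exact: (primeIB PP).
  apply: (primeI1 PQ); rewrite (_ : 1 = d - (d - 1)); last by ring.
  by apply: (primeIB PQ) => //; apply: Qd => //; exact/eqP.
move=> Pdm; apply: nonres; move: (_./2)%N Pdm => m Pdm.
have -> : d0 ^+ m - 1 = (d ^+ m - 1) - (d ^+ m - d0 ^+ m).
  by rewrite opprB [RHS]addrC addrA subrK.
apply: (primeIB PP) => //; rewrite subrXX mulrC; apply: (primeIM PP) => //.
by apply: integers_sum => i _; apply: integersM; exact: integersX.
Qed.

End ManyPrimes.

(** * Quadratic characters and Frobenius elements *)

Lemma Aint_iota (K : fieldExtType rat) (iota : {rmorphism K -> algC}) (d : K) :
  iota d \in Aint <-> integers d.
Proof.
have mapE (q : {poly int}) : map_poly iota (map_poly intr q) = map_poly intr q.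
  by rewrite -map_poly_comp; apply: eq_map_poly => a /=; rewrite rmorph_int.
split=> [|[q q_monic rq]].
  rewrite unfold_in => /floorpP[q Dq]; exists q.
    have [r [Dr mr] _] := minCpolyP (iota d).
    rewrite monicE -(@intr_inj algC (lead_coef q) 1) //.
    rewrite -(lead_coef_map_inj (@intr_inj algC)) // -Dq Dr lead_coef_map (monicP mr).
    by rewrite !rmorph1.
  by rewrite -(fmorph_root iota) mapE -Dq root_minCpoly.
apply: (@root_monic_Aint (map_poly intr q)); last 2 first.
- by rewrite monic_map.
- by apply/polyOverP => i; rewrite coef_map intr_int.
by rewrite -mapE fmorph_root.
Qed.

Section CharIntegers.
Variables (K : fieldExtType rat) (iota : {rmorphism K -> algC}) (chi : quad_char iota).
Local Notation G := (abs_gal iota).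
Local Notation O := (@integers K).
Local Notation B := (char_integers chi).
Implicit Types (g h : G) (x y : algC).

Definition gal_id : G := @AbsGal K iota (idfun : {rmorphism algC -> algC}) (fun=> erefl).

Lemma char_gal_id : chi gal_id = 1.
Proof. by have [s] := qc_cont chi; apply. Qed.

Lemma char_pm g : chi g = 1 \/ chi g = -1.
Proof.
by have /eqP := qc_sqr chi g; rewrite sqrf_eq1 => /orP[]/eqP; [left|right].
Qed.

Lemma char_integersB x y : B x -> B y -> B (x - y).
Proof. by move=> [Ax fx] [Ay fy]; split=> [|g gB]; rewrite ?rpredB ?rmorphB ?fx ?fy. Qed.
Lemma char_integersD x y : B x -> B y -> B (x + y).
Proof. by move=> [Ax fx] [Ay fy]; split=> [|g gB]; rewrite ?rpredD ?rmorphD ?fx ?fy. Qed.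
Lemma char_integersM x y : B x -> B y -> B (x * y).
Proof. by move=> [Ax fx] [Ay fy]; split=> [|g gB]; rewrite ?rpredM ?rmorphM /= ?fx ?fy. Qed.
Lemma char_integers_iota d : O d -> B (iota d).
Proof. by move=> Od; split=> [|g _]; [apply/Aint_iota|exact: gal_fix]. Qed.
Lemma char_integers_nat n : B n%:R.
Proof. by rewrite -(rmorph_nat iota); apply: char_integers_iota; exact: integers_nat. Qed.
Lemma char_integersX x n : B x -> B (x ^+ n).
Proof.
move=> Bx; elim: n => [|n IH]; first exact: (char_integers_nat 1).
by rewrite exprS; exact: char_integersM.
Qed.

(** Both g g and g h lie in the kernel of [chi], so the injective g sends g x and h x to the same
    element x. *)
Lemma char_neg_agree g h x : chi g = -1 -> chi h = -1 -> B x -> g x = h x.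
Proof.
move=> cg ch [_ fx]; apply: (fmorph_inj (gal_aut g)).
have := fx (gal_comp g g); have := fx (gal_comp g h).
by rewrite !qc_mul cg ch /= => -> // ->.
Qed.

Lemma char_integers_gal g x : B x -> B (g x).
Proof.
move=> Bx; have [Ax fx] := Bx; split=> [|h ch]; first by rewrite Aint_aut.
have [cg|cg] := char_pm g; first by rewrite fx // fx.
apply: (char_neg_agree (g := gal_comp h g)) => //.
by rewrite qc_mul ch cg mul1r.
Qed.

Lemma gal_invol g x : B x -> g (g x) = x.
Proof. by move=> [_ fx]; apply: (fx (gal_comp g g)); rewrite qc_mul -expr2 qc_sqr. Qed.

Lemma gal_fixed_integers x : x \in Aint -> (forall g, g x = x) ->
  exists2 d, O d & x = iota d.
Proof.
move=> Ax /abs_gal_fixed[d Dx]; exists d => //.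
by apply/(Aint_iota iota); rewrite -Dx.
Qed.

(** [s] is the conjugation of the quadratic extension cut out by [chi], or the identity when [chi]
    is trivial, so that both cases share one notion of trace and norm. *)
Lemma char_conj : exists s : G,
  (forall h x, B x -> h x = if chi h == 1 then x else s x) /\
  (chi s = -1 \/ forall h, chi h = 1).
Proof.
have [[s cs]|nex] := pselect (exists s, chi s = -1).
  exists s; split; last by left.
  move=> h x Bx; have [ch|ch] := char_pm h; first by rewrite ch eqxx; apply: Bx.2.
  by rewrite ch /=; apply: char_neg_agree.
have triv h : chi h = 1.
  by have [//|ch] := char_pm h; case: nex; exists h.
exists gal_id; split; last by right.
by move=> h x Bx; rewrite triv eqxx; apply: Bx.2.
Qed.

Lemma char_trace_norm (s : G) x :
  (forall h x, B x -> h x = if chi h == 1 then x else s x) -> B x ->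
  exists t n, [/\ O t, O n, x + s x = iota t & x * s x = iota n].
Proof.
move=> sP Bx; have Bsx := char_integers_gal s Bx.
have swap h : (h x = x /\ h (s x) = s x) \/ (h x = s x /\ h (s x) = x).
  rewrite (sP h _ Bx) (sP h _ Bsx); case: eqP => _; [by left|right; split=> //].
  exact: gal_invol.
have [|t Ot Dt] := @gal_fixed_integers (x + s x) (char_integersD Bx Bsx).1.
  by move=> h; rewrite rmorphD /=; case: (swap h) => -[-> ->] //; rewrite addrC.
have [|n On Dn] := @gal_fixed_integers (x * s x) (char_integersM Bx Bsx).1.
  by move=> h; rewrite rmorphM /=; case: (swap h) => -[-> ->] //; rewrite mulrC.
by exists t, n; split.
Qed.

(* Zorn's lemma on the ideals of [B] which meet [O_K] inside [P]; taking norms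
   shows that a maximal one contains [P]. *)
Lemma char_primes_above_exists p (P : set K) : prime p -> primes_above K p P ->
  exists Q, char_primes_above chi P Q.
Proof.
move=> p_pr PP.
have [s [sP _]] := char_conj.
pose fam := [set I : set algC | [/\ I `<=` B, forall x y, I x -> I y -> I (x + y),
  forall a x, B a -> I x -> I (a * x) & forall d, I (iota d) -> P d]].
have B0 := char_integers_nat 0; have B1 := char_integers_nat 1.
have [A [[sAB AD AM AP] Amax]] : exists A, fam A /\ forall J, A `<` J -> ~ fam J.
  apply: Zorn_bigcup => F sF totF; split.
  - by move=> x [I FI Ix]; have [sIB _ _ _] := sF _ FI; exact: sIB.
  - move=> x y [I FI Ix] [J FJ Jy]; have [_ ID _ _] := sF _ FI; have [_ JD _ _] := sF _ FJ.
    have [sIJ|sJI] := totF _ _ FI FJ; last by exists I => //; apply: ID => //; exact: sJI.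
    by exists J => //; apply: JD => //; exact: sIJ.
  - by move=> a x Ba [I FI Ix]; exists I => //; have [_ _ IM _] := sF _ FI; exact: IM.
  - by move=> d [I FI Id]; have [_ _ _] := sF _ FI; exact.
(* The family admits the empty set, which is the union of the empty chain in Zorn's lemma;
   maximality rules it out for [A], since the zero ideal is in the family. *)
have A0 : A 0.
  apply: contrapT => nA0.
  have [[x Ax]|nex] := pselect (exists x, A x).
    by apply: nA0; rewrite -(mul0r x); apply: AM.
  apply: (Amax [set 0]).
    split=> [x Ax|/(_ 0 erefl)//]; by case: nex; exists x.
  split=> [_ -> //|_ _ -> ->|a _ _ ->|d /eqP]; rewrite /= ?addr0 ?mulr0 //.
  by rewrite fmorph_eq0 => /eqP ->; exact: primeI0 PP.
(* By maximality, A + B a must meet iota(K) outside P. *)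
have Aext a : B a -> ~ A a -> exists d x b,
    [/\ ~ P d, A x, B b, O d & iota d = x + b * a].
  move=> Ba nAa; apply: contrapT => nex.
  apply: (Amax [set z | exists x b, [/\ A x, B b & z = x + b * a]]).
    split=> [x Ax|/(_ a)]; first by exists x, 0; rewrite mul0r addr0.
    by move=> sJA; apply/nAa/sJA; exists 0, 1; rewrite mul1r add0r.
  have sJB z : (exists x b, [/\ A x, B b & z = x + b * a]) -> B z.
    by move=> [x [b [Ax Bb ->]]]; apply: char_integersD; [exact: sAB|exact: char_integersM].
  split=> //.
  - move=> _ _ [x [b [Ax Bb ->]]] [y [c [Ay Bc ->]]]; exists (x + y), (b + c).
    by split; [exact: AD|exact: char_integersD|ring].
  - move=> c _ Bc [x [b [Ax Bb ->]]]; exists (c * x), (c * b).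
    by split; [exact: AM|exact: char_integersM|ring].
  - move=> d Jd; apply: contrapT => nPd; apply: nex.
    have [x [b [Ax Bb Dd]]] := Jd; exists d, x, b; split=> //.
    by apply/(Aint_iota iota); exact: (sJB _ Jd).1.
have AE : iota @^-1` A = P.
  apply/seteqP; split=> [d /AP//|d Pd]; apply: contrapT => nAd.
  have Od := primeI_sub PP Pd.
  have [e [x [b [nPe Ax Bb Oe De]]]] := Aext _ (char_integers_iota Od) nAd.
  have [t [n [Ot On Dt Dn]]] := char_trace_norm sP Bb.
  have Bsb := char_integers_gal s Bb.
  (* With x = e - b d, the product (e - s(b) d) x equals e^2 - (e t - d n) d, where t and n are the
     trace and norm of b. It comes from O_K, so e^2, and then e, would lie in P. *)
  have : A ((iota e - s b * iota d) * x).
    apply: AM => //; apply: char_integersB; first exact: char_integers_iota.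
    by apply: char_integersM => //; exact: char_integers_iota.
  have -> : (iota e - s b * iota d) * x = iota (e ^+ 2 - (e * t - d * n) * d).
    rewrite (_ : x = iota e - b * iota d); last by rewrite De addrK.
    by rewrite !(rmorphB, rmorphM, rmorphXn) /= -Dt -Dn; ring.
  move=> /AP Pe2; apply: nPe.
  have : P (e * e).
    rewrite (_ : e * e = (e ^+ 2 - (e * t - d * n) * d) + (e * t - d * n) * d); last by ring.
    apply: (primeID PP) => //; apply: (primeIM PP) => //.
    by apply: integersB; exact: integersM.
  by move=> /(primeI_or PP Oe Oe)[].
exists A; split=> //; split=> //.
- split; first by rewrite -(rmorph1 iota) => /AP; exact: primeI1 PP.
  move=> a b Ba Bb Aab; apply: contrapT => /not_orP[nAa nAb].
  have [d1 [x1 [b1 [nPd1 Ax1 Bb1 Od1 D1]]]] := Aext _ Ba nAa.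
  have [d2 [x2 [b2 [nPd2 Ax2 Bb2 Od2 D2]]]] := Aext _ Bb nAb.
  have : A (iota (d1 * d2)).
    rewrite rmorphM /= D1 D2.
    have -> : (x1 + b1 * a) * (x2 + b2 * b) =
        (x2 + b2 * b) * x1 + (b1 * a) * x2 + (b1 * b2) * (a * b) by ring.
    have BaM c e : B c -> B e -> B (c * e) by exact: char_integersM.
    have A1 : A ((x2 + b2 * b) * x1).
      apply: (AM _ _ _ Ax1); apply: char_integersD; [exact: sAB|exact: BaM].
    exact (AD _ _ (AD _ _ A1 (AM _ _ (BaM _ _ Bb1 Ba) Ax2)) (AM _ _ (BaM _ _ Bb1 Bb2) Aab)).
  by move=> /AP /(primeI_or PP Od1 Od2)[].
- exists (iota p%:R); first by rewrite -[A _]/((iota @^-1` A) p%:R) AE; exact: primeIp PP.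
  by rewrite rmorph_nat pnatr_eq0 -lt0n prime_gt0.
Qed.

End CharIntegers.

(** * Character values at P through Euler's criterion *)

Section CharAt.
Variables (K : fieldExtType rat) (iota : {rmorphism K -> algC}).
Variables (p : nat) (P : set K).
Hypotheses (p_pr : prime p) (p_odd : odd p) (PP : primes_above K p P).
Local Notation G := (abs_gal iota).
Local Notation O := (@integers K).
Local Notation N := (norm_ideal P).
Implicit Types (chi : quad_char iota).

(* [chi] is the character of K(sqrt d) / K for a [d] prime to [P]; as [P] is
   odd, this amounts to [chi] being unramified at [P]. *)
Definition unit_radicand chi (d : K) : Prop := [/\ O d, ~ P d
  & exists2 r : algC, r ^+ 2 = iota d & forall g : G, g r = (chi g)%:~R * r].

Section AbovePrime.
Variables (chi : quad_char iota) (Q : set algC).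
Hypothesis QP : char_primes_above chi P Q.
Local Notation B := (char_integers chi).

Lemma char_primeD x y : Q x -> Q y -> Q (x + y).
Proof. by case: QP => -[_ [_ +] _ _ _] _; apply. Qed.
Lemma char_prime0 : Q 0. Proof. by case: QP => -[_ [+ _] _ _ _] _. Qed.
Lemma char_primeM a x : B a -> Q x -> Q (a * x).
Proof. by case: QP => -[_ _ + _ _] _; apply. Qed.
Lemma char_primeN x : Q x -> Q (- x).
Proof.
move=> Qx; rewrite -mulN1r; apply: char_primeM => //.
by rewrite -sub0r; apply: char_integersB; [exact: (char_integers_nat _ 0)|exact: (char_integers_nat _ 1)].
Qed.
Lemma char_primeB x y : Q x -> Q y -> Q (x - y).
Proof. by move=> Qx /char_primeN; exact: char_primeD. Qed.
Lemma char_prime_or a b : B a -> B b -> Q (a * b) -> Q a \/ Q b.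
Proof. by case: QP => -[_ _ _ [_ +] _] _; apply. Qed.
Lemma char_prime_iota d : Q (iota d) <-> P d.
Proof. by case: QP => _ <-. Qed.
Lemma char_prime_trans y x z : Q (x - y) -> Q (y - z) -> Q (x - z).
Proof. by move=> /char_primeD /[apply]; rewrite addrA subrK. Qed.

Lemma char_prime_expB x y n : B x -> B y -> Q (x - y) -> Q (x ^+ n - y ^+ n).
Proof.
move=> Bx By Qxy; rewrite subrXX mulrC; apply: char_primeM => //.
elim/big_ind: _ => [||i _]; [exact: (char_integers_nat _ 0)|exact: char_integersD|].
by apply: char_integersM; exact: char_integersX.
Qed.

(** Q contains p, hence all the inner binomial coefficients; the exponent of interest is
    [norm_ideal P], a power of p. *)
Lemma char_prime_frob x y k : B x -> B y ->
  Q ((x + y) ^+ (p ^ k) - (x ^+ (p ^ k) + y ^+ (p ^ k))).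
Proof.
move=> Bx By; elim: k => [|k IH]; first by rewrite expn0 !expr1 subrr; exact: char_prime0.
have frob1 u v : B u -> B v -> Q ((u + v) ^+ p - (u ^+ p + v ^+ p)).
  move=> Bu Bv; rewrite exprDn -(prednK (prime_gt0 p_pr)) big_ord_recl big_ord_recr /=.
  rewrite subn0 bin0 mulr1n expr0 mulr1 /bump /= add1n subnn binn expr0 mulr1n mul1r.
  have E (a b c : algC) : a + (c + b) - (a + b) = c by ring.
  rewrite E.
  rewrite (prednK (prime_gt0 p_pr)).
  elim/big_ind: _ => [||i _]; [exact: char_prime0|exact: char_primeD|].
  have /dvdnP[c ->] : (p %| 'C(p, bump 0 i))%N.
    apply: prime_dvd_bin => //; rewrite /bump /= add1n.
    by rewrite -{2}(prednK (prime_gt0 p_pr)) ltnS ltn_ord.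
  rewrite mulrnA -mulr_natr; apply: char_primeM; last first.
    by rewrite -(rmorph_nat iota); apply/char_prime_iota; exact: primeIp PP.
  rewrite -mulr_natr; apply: char_integersM; last exact: char_integers_nat.
  by apply: char_integersM; exact: char_integersX.
have BX n u : B u -> B (u ^+ n) by exact: char_integersX.
have BD u v : B u -> B v -> B (u + v) by exact: char_integersD.
rewrite expnSr !exprM; apply: char_prime_trans (frob1 _ _ (BX _ _ Bx) (BX _ _ By)).
by apply: char_prime_expB => //; [apply: (BX _ _ (BD _ _ Bx By))|exact: (BD _ _ (BX _ _ Bx) (BX _ _ By))].
Qed.

End AbovePrime.

Lemma primeI_half d : O d -> ~ P d ->
  exists2 e : int, e = 1 \/ e = -1 & P (d ^+ (N.-1)./2 - e%:~R).
Proof.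
move=> Od nPd; have := primeI_expM p_pr PP Od nPd.
have E : N.-1 = ((N.-1)./2 * 2)%N by rewrite {1}(norm_ideal_odd p_pr PP p_odd) /= muln2.
rewrite {1}E; move: (N.-1)./2 => m.
have Om := integersX m Od; have O1 := @integers1 K.
rewrite exprM -[X in _ - X](expr1n _ 2) subr_sqr.
move=> /(primeI_or PP (integersB Om O1) (integersD Om O1))[H|H].
  by exists 1; [left|rewrite rmorph1].
by exists (-1); [right|rewrite rmorphN rmorph1 opprK].
Qed.

Lemma primeI_sign_inj (e e' : int) : e = 1 \/ e = -1 -> e' = 1 \/ e' = -1 ->
  P (e%:~R - e'%:~R) -> e = e'.
Proof.
have n2 := primeI2 p_pr PP p_odd.
have n2' : ~ P (- 2) by move/(primeIN PP); rewrite opprK.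
move=> [->|->] [->|->] // H; exfalso; [apply: n2|apply: n2'].
  by rewrite (_ : 2 = 1%:~R - (-1)%:~R) // rmorphN rmorph1 opprK.
by rewrite (_ : - 2 = (-1)%:~R - 1%:~R) // rmorphN rmorph1 -opprD.
Qed.

Lemma radicand_integral chi (d : K) (r : algC) : O d -> r ^+ 2 = iota d ->
  (forall g : G, g r = (chi g)%:~R * r) -> char_integers chi r.
Proof.
move=> Od r2 gr; split=> [|g cg]; last by rewrite gr cg mul1r.
have [q [qm rq]] : exists q : {poly int}, q \is monic /\ root (map_poly intr q) (iota d).
  have [q qm rq] := Od; exists q; split=> //.
  rewrite (_ : map_poly intr q = map_poly iota (map_poly intr q)) ?fmorph_root //.
  by rewrite -map_poly_comp; apply: eq_map_poly => a /=; rewrite rmorph_int.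
apply: (@root_monic_Aint (map_poly intr (q \Po 'X^2))).
- by rewrite map_comp_poly map_polyXn /root horner_comp hornerXn r2.
- by rewrite monic_map // monicE lead_coef_comp ?size_polyXn // (monicP qm) lead_coefXn expr1n mulr1.
- by apply/polyOverP => i; rewrite coef_map intr_int.
Qed.

(** An inertia element with chi g = -1 sends r to -r, so 2 r lies in Q and 4 d in P, although
    neither 2 nor d does. *)
Lemma char_unramified_radicand chi d : unit_radicand chi d -> char_unramified chi P.
Proof.
move=> [ Od nPd [r r2 gr]] Q QP g gin; have [//|cg] := char_pm chi g.
have Br := radicand_integral Od r2 gr; exfalso.
have Q2r : Q (g r - r) by exact: gin.
have : Q (iota (2 * 2 * d)).
  rewrite !rmorphM /= -r2 rmorph_nat.
  rewrite (_ : _ * _ = (- 2 * r) * (g r - r)); last by rewrite gr cg; ring.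
  apply: (char_primeM QP) => //; apply: char_integersM => //.
  rewrite -sub0r; apply: char_integersB; last exact: char_integers_nat.
  exact: (char_integers_nat _ 0).
have O2 := integers_nat K 2; have n2 := primeI2 p_pr PP p_odd.
move=> /(char_prime_iota QP) /(primeI_or PP (integersM O2 O2) Od)[|//].
by move=> /(primeI_or PP O2 O2)[].
Qed.

(** For integral x one has 2 d x = d t + c r with t and c in O_K. The Frobenius congruence therefore
    reduces to O_K, where Fermat's theorem applies, and to r, where r^N = d^((N-1)/2) r is e r
    modulo Q. The factor 2 d lies outside P and is cancelled at the end. *)
Lemma frobenius_exists chi d (e : int) Q : unit_radicand chi d -> e = 1 \/ e = -1 ->
  P (d ^+ (N.-1)./2 - e%:~R) -> char_primes_above chi P Q ->
  exists2 g, is_frobenius chi P Q g & chi g = e.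
Proof.
move=> [ Od nPd [r r2 gr]] e_pm Pe QP.
have Br := radicand_integral Od r2 gr.
have NE : N = ((N.-1)./2 * 2).+1 by rewrite {1}(norm_ideal_odd p_pr PP p_odd) muln2.
have [s [sP s_triv]] := char_conj chi.
have [g cg] : exists g, chi g = e.
  case: e_pm Pe => [->|->] Pe; first by exists (gal_id iota); exact: char_gal_id.
  case: s_triv => [cs|triv]; first by exists s.
  (* If [chi] were trivial, d would be a square in O_K and d^((N-1)/2) would be 1 modulo P, not
     -1. *)
  have [|r0 Or0 Dr0] := @gal_fixed_integers _ iota r Br.1.
    by move=> g; rewrite gr triv mul1r.
  have Dd : d = r0 ^+ 2 by apply: (fmorph_inj iota); rewrite -r2 Dr0 rmorphXn.
  have nPr0 : ~ P r0 by move=> Pr0; apply: nPd; rewrite Dd expr2; apply: (primeIM PP).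
  have := primeI_expM p_pr PP Or0 nPr0.
  have -> : N.-1 = (2 * (N.-1)./2)%N by rewrite {1}NE mulnC.
  rewrite exprM -Dd => P1; have : (1 : int) = -1.
    apply: primeI_sign_inj; [by left|by right|].
    exact: (primeI_trans PP (primeI_subC PP P1) Pe).
  by [].
exists g => // x Bx.
have Bsx := char_integers_gal s Bx.
have [t [n [Ot _ Dt _]]] := char_trace_norm sP Bx.
have Bc : char_integers chi ((x - s x) * r).
  by apply: char_integersM => //; exact: char_integersB.
(* Outside the kernel of [chi] both x - s x and r change sign, so their product is invariant and
   comes from O_K. *)
have [|c Oc Dc] := @gal_fixed_integers _ iota ((x - s x) * r) Bc.1.
  move=> h; rewrite rmorphM rmorphB /= gr (sP h _ Bx) (sP h _ Bsx).
  have [->|ch] := char_pm chi h; first by rewrite eqxx mul1r.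
  by rewrite ch /= (gal_invol s Bx) rmorphN rmorph1; ring.
have D2dx : iota (2 * d) * x = iota (d * t) + iota c * r.
  by rewrite -Dc !rmorphM /= -Dt rmorph_nat -r2; ring.
have B_iota y : O y -> char_integers chi (iota y) by exact: char_integers_iota.
have Odt := integersM Od Ot; have O2d := integersM (integers_nat K 2) Od.
have fermatQ y : O y -> Q (iota y ^+ N - iota y).
  by move=> Oy; rewrite -rmorphXn -rmorphB; apply/(char_prime_iota QP)/(fermat_primeI p_pr PP).
have rN : Q (r ^+ N - e%:~R * r).
  rewrite {1}NE exprS mulnC exprM r2 -rmorphXn mulrC -mulrBl mulrC.
  rewrite -(rmorph_int iota) -rmorphB; apply: (char_primeM QP) => //.
  exact/(char_prime_iota QP).
have Bgx := char_integers_gal g Bx.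
have BxN := char_integersX N Bx.
have BM u v : char_integers chi u -> char_integers chi v -> char_integers chi (u * v).
  exact: char_integersM.
have QB := char_primeB QP; have QD := char_primeD QP; have QM := char_primeM QP.
have : Q (iota (2 * d) * (g x - x ^+ N)).
  have -> : iota (2 * d) * (g x - x ^+ N) =
     - ((iota (d * t) + iota c * r) ^+ N - (iota (d * t) ^+ N + (iota c * r) ^+ N))
     - (iota (d * t) ^+ N - iota (d * t))
     - (r ^+ N * (iota c ^+ N - iota c) + iota c * (r ^+ N - e%:~R * r))
     + x ^+ N * (iota (2 * d) ^+ N - iota (2 * d)).
    rewrite -D2dx !exprMn mulrBr.
    have -> : iota (2 * d) * g x = iota (d * t) + iota c * (e%:~R * r).
      by rewrite -(gal_fix g) -rmorphM /= D2dx rmorphD (rmorphM _ (iota c)) /= !gal_fix gr cg.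
    have E (A AN u uN v vN D DN X w : algC) : A + u * (w * v) - D * X =
        - (DN * X - (AN + uN * vN)) - (AN - A) - (vN * (uN - u) + u * (vN - w * v))
        + X * (DN - D) by ring.
    exact: E.
  apply: (QD) => //; last by apply: (QM) => //; exact: fermatQ.
  apply: (QB); first apply: (QB).
  - apply: (char_primeN QP); rewrite (norm_ideal_expE p_pr PP).2.
    by apply: (char_prime_frob QP); [exact: B_iota|apply: (BM) => //; exact: B_iota].
  - exact: fermatQ.
  - apply: (QD); apply: (QM); [exact: char_integersX|exact: fermatQ|exact: B_iota|exact: rN].
have n2 := primeI2 p_pr PP p_odd.
move=> /(char_prime_or QP (B_iota _ O2d) (char_integersB Bgx BxN))[|//].
by move=> /(char_prime_iota QP) /(primeI_or PP (integers_nat K 2) Od)[].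
Qed.

(** Evaluate the Frobenius element at r: the element r (g r - r^N) of Q equals d (chi g -
    d^((N-1)/2)), which comes from K. *)
Lemma frobenius_value chi d (e : int) Q g : unit_radicand chi d -> e = 1 \/ e = -1 ->
  P (d ^+ (N.-1)./2 - e%:~R) -> char_primes_above chi P Q ->
  is_frobenius chi P Q g -> chi g = e.
Proof.
move=> [ Od nPd [r r2 gr]] e_pm Pe QP fg.
have Br := radicand_integral Od r2 gr.
have NE : N = ((N.-1)./2 * 2).+1 by rewrite {1}(norm_ideal_odd p_pr PP p_odd) muln2.
have Odm := integersX (N.-1)./2 Od.
have : Q (iota (d * ((chi g)%:~R - d ^+ (N.-1)./2))).
  rewrite (_ : iota _ = r * (g r - r ^+ N)); first by apply: (char_primeM QP) => //; exact: fg.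
  rewrite {2}NE exprS mulnC exprM r2 gr -rmorphXn rmorphM rmorphB /= rmorph_int -r2.
  have E (c X : algC) : r ^+ 2 * (c - X) = r * (c * r - r * X) by ring.
  exact: E.
move=> /(char_prime_iota QP) /(primeI_or PP Od (integersB (integers_int K _) Odm))[//|H].
apply: primeI_sign_inj => //; first exact: char_pm.
exact: (primeI_trans PP H Pe).
Qed.

(** Frobenius elements exist and all take the sign given by Euler's criterion, so [xget] picks that
    sign and not its default. *)
Lemma char_at_radicand chi d : unit_radicand chi d ->
  (char_at chi P = 1 \/ char_at chi P = -1) /\
  P (d ^+ (N.-1)./2 - (char_at chi P)%:~R).
Proof.
move=> U; have [ Od nPd _] := U.
have [e e_pm Pe] := primeI_half Od nPd.
suff -> : char_at chi P = e by [].
rewrite /char_at asboolT; last exact: char_unramified_radicand U.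
have [Q QP] := char_primes_above_exists chi p_pr PP.
have [g fg cg] := frobenius_exists U e_pm Pe QP.
apply: xget_subset1; first by exists Q, g.
move=> a b [Q1 [g1 [Q1P f1 ->]]] [Q2 [g2 [Q2P f2 ->]]].
by rewrite (frobenius_value U e_pm Pe Q1P f1) (frobenius_value U e_pm Pe Q2P f2).
Qed.

(** If [chi] is nontrivial and unramified at P, the conjugation s is not in the inertia group at Q,
    so some r = s x - x lies outside Q; s negates r, and d = r^2 comes from O_K. *)
Lemma char_at_neq0 chi : char_at chi P != 0 -> exists d, unit_radicand chi d.
Proof.
rewrite /char_at; case: asboolP => [unr|_]; last by rewrite eqxx.
case: xgetP => [a _ [Q [g [QP _ _]]] _|_]; last by rewrite eqxx.
have [s [sP [cs|triv]]] := char_conj chi; last first.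
  exists 1; split; [exact: integers1|exact: primeI1 PP|exists 1].
    by rewrite expr1n rmorph1.
  by move=> h; rewrite rmorph1 triv mul1r.
have : ~ in_inertia chi Q s by move=> /unr -/(_ QP); rewrite cs.
move=> /existsNP[x /not_implyP[Bx nQ]].
have Bsx := char_integers_gal s Bx.
pose r := s x - x; have Br : char_integers chi r by exact: char_integersB.
have hr (h : G) : h r = (chi h)%:~R * r.
  rewrite rmorphB /= (sP h _ Bx) (sP h _ Bsx).
  have [->|ch] := char_pm chi h; first by rewrite eqxx mul1r.
  by rewrite ch /= (gal_invol s Bx) rmorphN rmorph1 mulN1r opprB.
have [|d Od Dd] := @gal_fixed_integers _ iota (r ^+ 2) (char_integersX 2 Br).1.
  by move=> h; rewrite rmorphXn /= hr exprMn -rmorphXn /= qc_sqr mul1r.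
exists d; split=> //; last by exists r.
move=> /(char_prime_iota QP); rewrite -Dd expr2 => /(char_prime_or QP Br Br)[]//.
Qed.

Lemma unit_radicandM (c1 c2 : quad_char iota) d1 d2 : unit_radicand c1 d1 -> unit_radicand c2 d2 ->
  unit_radicand (qmul c1 c2) (d1 * d2).
Proof.
move=> [Od1 n1 [r1 s1 g1]] [Od2 n2 [r2 s2 g2]]; split; first exact: integersM.
  by move=> /(primeI_or PP Od1 Od2)[].
exists (r1 * r2); first by rewrite exprMn s1 s2 rmorphM.
by move=> g; rewrite !rmorphM /= g1 g2 ?rmorphM mulrACA.
Qed.

Lemma char_atM (c1 c2 : quad_char iota) : char_at c2 P != 0 ->
  char_at (qmul c1 c2) P = char_at c1 P * char_at c2 P.
Proof.
move=> /char_at_neq0[d2 U2]; have [pm2 P2] := char_at_radicand U2.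
have [/eqP c10|/char_at_neq0[d1 U1]] := boolP (char_at c1 P == 0); last first.
  have [pm1 P1] := char_at_radicand U1; have [pm P12] := char_at_radicand (unit_radicandM U1 U2).
  apply: primeI_sign_inj => //.
    by case: pm1 => ->; case: pm2 => ->; rewrite ?mul1r ?mulrN1 ?opprK; auto.
  apply: (primeI_trans PP (primeI_subC PP P12)).
  have [Od1 _ _] := U1; have [Od2 _ _] := U2; move: (_./2) P1 P2 => m P1 P2.
  rewrite exprMn rmorphM /=.
  set a := (char_at c1 P)%:~R in P1 *; set b := (char_at c2 P)%:~R in P2 *.
  rewrite (_ : _ - _ = d2 ^+ m * (d1 ^+ m - a) + a * (d2 ^+ m - b)); last by ring.
  by apply: (primeID PP); apply: (primeIM PP) => //; [exact: integersX|exact: integers_int].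
(* If c1 c2 had a unit radicand d12, then c1 = (c1 c2) c2 would have the unit radicand d12 d2 and a
   nonzero value. *)
rewrite c10 mul0r; apply/eqP/negPn/negP => /char_at_neq0[d12 U12].
suff U1 : unit_radicand c1 (d12 * d2).
  by have [[] ] := char_at_radicand U1; rewrite c10.
have [Od1 n1 [r1 s1 g1]] := U12; have [Od2 n2 [r2 s2 g2]] := U2.
split; first exact: integersM.
  by move=> /(primeI_or PP Od1 Od2)[].
exists (r1 * r2); first by rewrite exprMn s1 s2 rmorphM.
move=> g; rewrite !rmorphM /= g1 g2 /= mulrACA -rmorphM /= -mulrA -expr2 qc_sqr mulr1.
by [].
Qed.

Lemma char_at_triv chi : (forall g, chi g = 1) -> char_at chi P = 1.
Proof.
move=> triv; have U : unit_radicand chi 1.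
  split; [exact: integers1|exact: primeI1 PP|exists 1; first by rewrite expr1n rmorph1].
  by move=> h; rewrite rmorph1 triv mul1r.
have [pm] := char_at_radicand U; rewrite expr1n => H.
by apply/esym/primeI_sign_inj => //; left.
Qed.

End CharAt.

Lemma char_at_pm (K : fieldExtType rat) (iota : {rmorphism K -> algC})
    (chi : quad_char iota) (P : set K) :
  [\/ char_at chi P = 0, char_at chi P = 1 | char_at chi P = -1].
Proof.
rewrite /char_at; case: asboolP => [_|_]; last by constructor 1.
case: xgetP => [a _ [Q [g [_ _ ->]]]|_]; last by constructor 1.
by have [->|->] := char_pm chi g; [constructor 2|constructor 3].
Qed.

Lemma quad_char_exists (K : fieldExtType rat) (iota : {rmorphism K -> algC}) (d : K) :
  d != 0 -> exists (chi : quad_char iota) (r : algC),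
    r ^+ 2 = iota d /\ forall g : abs_gal iota, g r = (chi g)%:~R * r.
Proof.
move=> d0; pose r := sqrtC (iota d); have r2 : r ^+ 2 = iota d by rewrite sqrtCK.
have r0 : r != 0 by rewrite sqrtC_eq0 fmorph_eq0.
pose f (g : abs_gal iota) : int := if g r == r then 1 else -1.
have gr (g : abs_gal iota) : g r = (f g)%:~R * r.
  rewrite /f; case: eqP => [->|/eqP gr]; first by rewrite mul1r.
  have : (g r) ^+ 2 == r ^+ 2 by rewrite -rmorphXn /= r2 gal_fix.
  by rewrite eqf_sqr (negPf gr) => /eqP ->; rewrite rmorphN rmorph1 mulN1r.
have f2 g : f g ^+ 2 = 1 by rewrite /f; case: ifP.
have fM g h : f (gal_comp g h) = f g * f h.
  apply: (@intr_inj algC); apply: (mulIf r0); rewrite -gr /= gr rmorphM /= rmorph_int.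
  by rewrite (gr g) rmorphM /= mulrCA mulrA.
have fc : exists s : seq algC, forall g : abs_gal iota,
    (forall x, x \in s -> g x = x) -> f g = 1.
  by exists [:: r] => g gs; rewrite /f gs ?inE ?eqxx.
by exists (QuadChar fM f2 fc), r.
Qed.

(** The character of K(sqrt d) for d a nonresidue modulo P and congruent to 1 modulo the other
    primes above p; Euler's criterion reads off its values. *)
Lemma char_separate (K : fieldExtType rat) (iota : {rmorphism K -> algC}) p (P : set K) :
  prime p -> odd p -> primes_above K p P -> exists chi : quad_char iota,
    char_at chi P = -1 /\
    forall Q, primes_above K p Q -> Q <> P -> char_at chi Q = 1.
Proof.
move=> p_pr p_odd PP; have [d [ Od nd nres d1]] := nonresidue_crt p_pr p_odd PP.
have d0 : d != 0 by apply: contra_notN (nd _ PP) => /eqP ->; exact: primeI0 PP.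
have [chi [r [r2 gr]]] := quad_char_exists iota d0; exists chi.
have U Q : primes_above K p Q -> unit_radicand Q chi d.
  by move=> PQ; split=> //; [exact: nd|exists r].
split=> [|Q PQ QP].
  have [[e|//] Pe] := char_at_radicand p_pr p_odd PP (U _ PP).
  by rewrite e in Pe; case: nres.
have [pm Qe] := char_at_radicand p_pr p_odd PQ (U _ PQ).
apply: (primeI_sign_inj p_pr p_odd PQ) => //; first by left.
have := d1 _ PQ QP; move: (_./2) Qe => m Qe Qd1.
apply: (primeI_trans PQ (primeI_subC PQ Qe)).
rewrite -(expr1n K m) subrXX mulrC; apply: (primeIM PQ) => //.
apply: integers_sum => i _; apply: integersM; apply: integersX => //; exact: integers1.
Qed.

(** * Uniqueness of Euler products *)

(** This norm is submultiplicative and controls values on [0, 1]: a polynomial divisible by T^k is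
    there at most its norm times t^k. *)
Definition l1norm (f : {poly int}) : int := \sum_(i < size f) `|f`_i|.

Lemma l1normE n (f : {poly int}) : (size f <= n)%N -> l1norm f = \sum_(i < n) `|f`_i|.
Proof.
move=> le_n; rewrite /l1norm (big_ord_widen _ (fun i => `|f`_i|) le_n) big_mkcond.
apply: eq_bigr => i _; case: ltnP => // le_i.
by rewrite nth_default ?normr0.
Qed.

Lemma l1norm_ge0 f : 0 <= l1norm f.
Proof. by apply: sumr_ge0. Qed.

Lemma l1normD f g : l1norm (f + g) <= l1norm f + l1norm g.
Proof.
pose n := maxn (size f) (size g).
rewrite (@l1normE n) ?size_polyD // (@l1normE n f) ?leq_maxl // (@l1normE n g) ?leq_maxr //.
by rewrite -big_split; apply: ler_sum => i _; rewrite coefD ler_normD.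
Qed.

Lemma l1normN f : l1norm (- f) = l1norm f.
Proof. by rewrite /l1norm size_polyN; apply: eq_bigr => i _; rewrite coefN normrN. Qed.

Lemma l1normB f g : l1norm (f - g) <= l1norm f + l1norm g.
Proof. by rewrite -(l1normN g) l1normD. Qed.

Lemma l1norm_sub (f g : {poly int}) : (forall i, g`_i = f`_i \/ g`_i = 0) -> l1norm g <= l1norm f.
Proof.
move=> fg; pose n := maxn (size f) (size g).
rewrite (@l1normE n f) ?leq_maxl // (@l1normE n g) ?leq_maxr //.
by apply: ler_sum => i _; have [->|->] := fg i; rewrite ?normr0.
Qed.

Lemma l1normZ c f : l1norm (c *: f) = `|c| * l1norm f.
Proof.
rewrite (@l1normE (size f)) ?size_scale_leq // mulr_sumr.
by apply: eq_bigr => i _; rewrite coefZ normrM.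
Qed.

Lemma l1normMXaddC f c : l1norm (f * 'X + c%:P) = l1norm f + `|c|.
Proof.
rewrite (@l1normE (size f).+1); last first.
  by rewrite size_MXaddC; case: ifP.
rewrite big_ord_recl addrC coefD coefMX coefC /= add0r; congr (_ + _).
by apply: eq_bigr => i _; rewrite coefD coefMX coefC /= addr0.
Qed.

Lemma l1norm_mulX f : l1norm (f * 'X) = l1norm f.
Proof. by rewrite -[f * 'X]addr0 -polyC0 l1normMXaddC normr0 addr0. Qed.

Lemma l1normXn n : l1norm 'X^n = 1.
Proof.
elim: n => [|n IH]; last by rewrite exprSr l1norm_mulX.
by rewrite expr0 (@l1normE 1) ?size_poly1 // big_ord1 coef1.
Qed.

Lemma l1normM f g : l1norm (f * g) <= l1norm f * l1norm g.
Proof.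
elim/poly_ind: f => [|f c IH]; first by rewrite mul0r /l1norm size_poly0 !big_ord0 mul0r.
rewrite l1normMXaddC !mulrDl mulrAC mul_polyC; apply: le_trans (l1normD _ _) _.
by rewrite l1norm_mulX l1normZ lerD2r.
Qed.

Lemma l1norm_prod (I : Type) (r : seq I) (f : I -> {poly int}) (c : int) :
  0 <= c -> (forall i, l1norm (f i) <= c) ->
  l1norm (\prod_(i <- r) f i) <= c ^+ size r.
Proof.
move=> c0 fc; elim: r => [|i r IH]; first by rewrite big_nil expr0 -(expr0 'X) l1normXn.
rewrite big_cons exprS; apply: le_trans (l1normM _ _) _.
by apply: ler_pM => //; exact: l1norm_ge0.
Qed.

(** * Real Euler products and their logarithms *)

Section EulerUnique.
Variable R : realType.
Implicit Types (f g : {poly int}) (t x y : R).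

Definition reval f t : R := (map_poly intr f).[t].

Lemma revalB f g t : reval (f - g) t = reval f t - reval g t.
Proof. by rewrite /reval rmorphB hornerD hornerN. Qed.

Lemma reval_le f t k : 0 <= t <= 1 -> (forall i, (i < k)%N -> f`_i = 0) ->
  `|reval f t| <= (l1norm f)%:~R * t ^+ k.
Proof.
move=> /andP[t0 t1] fk; rewrite /reval (horner_coef_wide t (n := size f)); last first.
  exact: size_poly.
rewrite rmorph_sum mulr_suml; apply: le_trans (ler_norm_sum _ _ _) _.
apply: ler_sum => i _; rewrite coef_map normrM normrX /= (ger0_norm t0) -intr_norm.
have [lt_ik|le_ki] := ltnP i k; first by rewrite fk // normr0 !mul0r.
by rewrite ler_wpM2l ?ler0z // ler_wiXn2l.
Qed.

Lemma ln_diff x y : 0 < x -> 0 < y -> ln x - ln y <= (x - y) / y.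
Proof.
move=> x0 y0; rewrite -ln_div ?posrE // (_ : x / y = 1 + (x - y) / y); last first.
  by field; rewrite gt_eqF.
apply: le_ln1Dx; rewrite ltr_pdivlMr // mulN1r ltrBrDl subrr //.
Qed.

Lemma ln_diff_le x y : 1/2 <= x -> 1/2 <= y -> `|ln x - ln y| <= 2 * `|x - y|.
Proof.
move=> hx hy; have x0 : 0 < x by lra. have y0 : 0 < y by lra.
have hyp (u v : R) : 1/2 <= u -> 1/2 <= v -> ln u - ln v <= 2 * `|u - v|.
  move=> hu hv; have v0 : 0 < v by lra. have u0 : 0 < u by lra.
  apply: le_trans (ln_diff u0 v0) _; rewrite ler_pdivrMr //.
  have := ler_norm (u - v); have := normr_ge0 (u - v); nra.
by rewrite ler_norml lerNl opprB {1}distrC !hyp.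
Qed.

Lemma ln_diff_ge x y : 0 < x <= 2 -> 0 < y <= 2 -> `|x - y| <= 2 * `|ln x - ln y|.
Proof.
move=> /andP[x0 x2] /andP[y0 y2].
have hyp (u v : R) : 0 < u -> 0 < v -> u <= 2 -> u - v <= 2 * `|ln u - ln v|.
  move=> u0 v0 u2; have := ln_diff v0 u0.
  rewrite ler_pdivlMr // => H.
  have := ler_norm (ln u - ln v); have := normr_ge0 (ln u - ln v); nra.
rewrite ler_norml lerNl opprB hyp // andbT distrC; exact: hyp.
Qed.

(** A telescoping majorant, 1/q - 1/(q+1) for q > 0; the term at q = 0 is 0 because the inverse of 0
    is 0. *)
Definition inv_pronic (q : nat) : R := (q * q.+1)%:R^-1.

Lemma sum_inv_pronic_le N : \sum_(q < N) inv_pronic q <= 1.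
Proof.
suff H : \sum_(q < N.+1) inv_pronic q = 1 - N.+1%:R^-1.
  apply: (@le_trans _ _ (\sum_(q < N.+1) inv_pronic q)); first by rewrite big_ord_recr lerDl invr_ge0.
  by rewrite H gerBl invr_ge0.
elim: N => [|N IH]; first by rewrite big_ord1 /inv_pronic mul0n invr0 invr1 subrr.
rewrite big_ord_recr IH /inv_pronic /= natrM -![N.+2%:R]natr1 -!natr1.
have N0 : 0 <= N%:R :> R by [].
by field; rewrite !gt_eqF //; lra.
Qed.

Lemma cvg_inv_pronic : cvgn (series inv_pronic).
Proof.
apply: nondecreasing_is_cvgn.
  apply/nondecreasing_seqP => n; rewrite seriesSr lerDl invr_ge0 //.
by exists 1 => _ [n _ <-]; rewrite /series /= big_mkord sum_inv_pronic_le.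
Qed.

Definition inv_pow (m q : nat) : R := (q%:R^-1) ^+ m.

Lemma inv_cube_le_pronic q : (1 < q)%N -> (q%:R^-1 : R) ^+ 3 <= inv_pronic q.
Proof.
move=> q1; rewrite /inv_pronic exprVn -natrX lef_pV2 ?posrE ?ltr0n ?expn_gt0 ?muln_gt0 ?(ltnW q1) //.
by rewrite ler_nat; nia.
Qed.

Section OneSide.
Variables (F : nat -> {poly int}) (C : nat).
Hypothesis F0 : forall q, prime q -> (F q)`_0 = 1.
Hypothesis FC : forall q, prime q -> l1norm (F q) <= (q ^ C)%:Z.
Variable m : nat.
Hypothesis hm : (C + 3 <= m)%N.
Local Notation t := (inv_pow m).

Lemma prime_inv_itv q : prime q -> 0 < (q%:R^-1 : R) <= 1/2.
Proof.
move=> /prime_gt1 q1; have q2 : 2 <= q%:R :> R by rewrite ler_nat.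
rewrite invr_gt0; apply/andP; split; first by lra.
by rewrite div1r lef_pV2 ?posrE //; lra.
Qed.

(** In m >= C + 3 the C absorbs the coefficient bound; the 3 leaves q^-3, which keeps the factor
    within 1/2 of 1 and is dominated by [inv_pronic]. *)
Lemma pow_small q (c : R) : prime q -> 0 <= c <= (q ^ C)%:R ->
  c * t q <= (q%:R^-1) ^+ 3.
Proof.
move=> q_pr /andP[c0 cC]; have /andP[i0 i1] := prime_inv_itv q_pr.
have q0 : q%:R != 0 :> R by rewrite pnatr_eq0 -lt0n prime_gt0.
rewrite /inv_pow -(subnKC hm) -addnA exprD.
apply: (@le_trans _ _ ((q ^ C)%:R * (q%:R^-1 ^+ C * q%:R^-1 ^+ (3 + (m - (C + 3)))))).
  by apply: ler_wpM2r => //; rewrite mulr_ge0 // exprn_ge0 // ltW.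
rewrite mulrA natrX -exprMn mulfV // expr1n mul1r.
by apply: ler_wiXn2l; rewrite ?leq_addr //; lra.
Qed.

Lemma inv_pow_itv q : prime q -> 0 <= t q <= 1.
Proof.
move=> q_pr; have /andP[i0 i1] := prime_inv_itv q_pr.
by rewrite /inv_pow exprn_ge0 ?exprn_ile1 //; lra.
Qed.

Lemma reval_near1 q : prime q -> `|reval (F q) (t q) - 1| <= (q%:R^-1) ^+ 3.
Proof.
move=> q_pr.
have -> : reval (F q) (t q) - 1 = reval (F q - 1) (t q).
  by rewrite revalB /reval rmorph1 hornerC.
apply: le_trans (@reval_le _ _ 1 (inv_pow_itv q_pr) _) _.
  by case=> // _; rewrite coefB coef1 F0 // subrr.
rewrite expr1; apply: pow_small => //; rewrite ler0z l1norm_ge0 /=.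
rewrite -[_%:R]/(((q ^ C)%:Z)%:~R) ler_int; apply: le_trans (FC q_pr).
apply: l1norm_sub => -[|i]; rewrite coefB coef1 /= ?subr0; [right|by left].
by rewrite F0 // subrr.
Qed.

Lemma reval_itv q : prime q -> 1/2 <= reval (F q) (t q) <= 3/2.
Proof.
move=> q_pr; have /andP[i0 i1] := prime_inv_itv q_pr.
have h : (q%:R^-1 : R) ^+ 3 <= 1/2.
  rewrite !exprS expr0 mulr1; nra.
by have := reval_near1 q_pr; rewrite ler_norml => /andP[]; lra.
Qed.

Definition log_factor (q : nat) : R := if prime q then ln (reval (F q) (t q)) else 0.

Lemma log_factor_le q : `|log_factor q| <= 2 * inv_pronic q.
Proof.
rewrite /log_factor; case: ifP => q_pr; last by rewrite normr0 mulr_ge0 ?invr_ge0.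
have /andP[h _] := reval_itv q_pr.
have := ln_diff_le h (y := 1); rewrite ln1 subr0 => H.
apply: (le_trans (H _)); first by lra.
rewrite ler_pM2l //; apply: le_trans (reval_near1 q_pr) _.
by apply: inv_cube_le_pronic; exact: prime_gt1.
Qed.

Lemma cvg_log_series : cvgn (series log_factor).
Proof.
apply: normed_cvg; apply: (@series_le_cvg _ _ (fun q => 2 * inv_pronic q)).
- by move=> n; exact: normr_ge0.
- by move=> n; rewrite mulr_ge0 ?invr_ge0.
- exact: log_factor_le.
- have -> : (fun q => 2 * inv_pronic q) = 2 *: inv_pronic by [].
  by apply: is_cvg_seriesZ; exact: cvg_inv_pronic.
Qed.

Lemma prod_log N : \prod_(q < N | prime q) (reval (F q) (t q))^-1 = expR (- series log_factor N).
Proof.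
rewrite /series /= big_mkord; elim: N => [|N IH]; first by rewrite !big_ord0 oppr0 expR0.
rewrite big_mkcond big_ord_recr -big_mkcond /= IH big_ord_recr /= opprD expRD; congr (_ * _).
rewrite [log_factor N]/log_factor; case: ifP => q_pr; last by rewrite oppr0 expR0.
by rewrite expRN lnK // posrE; have := reval_itv q_pr; lra.
Qed.

Lemma cvg_prod :
  (fun N => \prod_(q < N | prime q) (reval (F q) (t q))^-1) @ \oo --> expR (- limn (series log_factor)).
Proof.
under eq_fun do rewrite prod_log.
apply: (@cvg_comp _ _ _ (fun N => - series log_factor N) expR _ (nbhs (- limn (series log_factor)))).
  by apply: cvgN; exact: cvg_log_series.
exact: continuous_expR.
Qed.

End OneSide.
End EulerUnique.

(* Both products are exponentials of sums over primes.  At the least prime power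
   p^k such that the k-th coefficients of the factors at p differ (and no
   earlier ones do), the logarithms differ by about p^(-km), while the other
   primes contribute at most a constant times (p^k + 1)^(-m). *)
Lemma euler_product_inj (R : realType) (F G : nat -> {poly int}) (C : nat) :
  (forall q, prime q -> (F q)`_0 = 1) -> (forall q, prime q -> (G q)`_0 = 1) ->
  (forall q, prime q -> l1norm (F q) <= (q ^ C)%:Z) ->
  (forall q, prime q -> l1norm (G q) <= (q ^ C)%:Z) ->
  (forall m, (C + 3 <= m)%N ->
    lim ((fun N => \prod_(q < N | prime q) (reval (F q) (inv_pow R m q))^-1) @ \oo) =
    lim ((fun N => \prod_(q < N | prime q) (reval (G q) (inv_pow R m q))^-1) @ \oo)) ->
  forall q, prime q -> F q = G q.
Proof.
move=> F0 G0 FC GC eqL q0 q0_pr; apply: contrapT => neq.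
pose a F m q := log_factor R F m q.
have sum0 m : (C + 3 <= m)%N -> series (fun q => a F m q - a G m q) @ \oo --> (0 : R).
  move=> hm; have := eqL m hm.
  rewrite (cvg_lim (@norm_hausdorff _ _) (cvg_prod F0 FC hm)).
  rewrite (cvg_lim (@norm_hausdorff _ _) (cvg_prod G0 GC hm)) => /expR_inj/oppr_inj e.
  have -> : series (fun q => a F m q - a G m q) = series (a F m) - series (a G m).
    by apply/funext => n; rewrite /series /= sumrB.
  rewrite -(subrr (limn (series (log_factor R G m)))) -{1}e.
  by apply: cvgB; [exact: (cvg_log_series F0 FC hm)|exact: (cvg_log_series G0 GC hm)].
pose dif q k := (forall i, (i < k)%N -> (F q)`_i = (G q)`_i) /\ (F q)`_k <> (G q)`_k.
have exdif q : F q <> G q -> exists k, dif q k.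
  move=> neq'; have ex : exists k, (F q)`_k != (G q)`_k.
    apply: contrapT => nex; apply: neq'; apply/polyP => i.
    by apply/eqP; apply: contrapT => /negP ni; apply: nex; exists i.
  case: (ex_minnP ex) => k /eqP nk kmin; exists k; split=> // i lt_ik.
  by apply/eqP; apply: contrapT => /negP /kmin; rewrite leqNgt lt_ik.
pose S M := `[< exists q k, [/\ prime q, dif q k & M = (q ^ k)%N] >].
have exS : exists M, S M.
  have [k dk] := exdif _ neq; exists (q0 ^ k)%N; apply/asboolP; by exists q0, k.
case: (ex_minnP exS) => M /asboolP[p [k [p_pr dk DM]]] Mmin {q0 q0_pr neq exS}.
have dif_gt0 q l : prime q -> dif q l -> (0 < l)%N.
  by move=> q_pr [_ neq]; case: l neq => // -[]; rewrite F0 ?G0.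
have k0 := dif_gt0 _ _ p_pr dk.
have M0 : (0 < M)%N by rewrite DM expn_gt0 prime_gt0.
have l1_le q : prime q -> l1norm (F q - G q) <= 2 * (q ^ C)%:Z.
  move=> q_pr; apply: le_trans (l1normB _ _) _; rewrite mulr_natl mulr2n.
  by apply: lerD; [exact: FC|exact: GC].
have l1_leR q : prime q -> ((l1norm (F q - G q))%:~R : R) <= 2 * (q ^ C)%:R.
  move=> q_pr; rewrite (_ : 2 * _ = (2 * (q ^ C)%:Z)%:~R); last by rewrite intrM.
  by rewrite ler_int; exact: l1_le.
(* In the exponent C + 3 + j, the C absorbs the coefficients, the 3 makes the sum over q converge
   and j gives the decay. The 4 is a 2 from [ln_diff_le] and a 2 from the norm of F q - G q. *)
have tail (j q : nat) : prime q -> q != p ->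
    `|a F (C + 3 + j) q - a G (C + 3 + j) q| <= 4 * (M.+1%:R^-1) ^+ j * inv_pronic R q.
  move=> q_pr neq_qp; set m := (C + 3 + j)%N; have hm : (C + 3 <= m)%N by exact: leq_addr.
  have [eqFG|/exdif[l dl]] := pselect (F q = G q).
    rewrite /a /log_factor q_pr eqFG subrr normr0.
    by rewrite !mulr_ge0 ?exprn_ge0 ?invr_ge0.
  have l0 := dif_gt0 _ _ q_pr dl.
  pose w := (q ^ l)%N.
  (* Minimality gives M <= w, and M, a power of p, cannot be a positive power of q. *)
  have Mw : (M < w)%N.
    rewrite ltn_neqAle Mmin ?andbT; last by apply/asboolP; exists q, l.
    apply/eqP => eMw; have : (p %| q ^ l)%N by rewrite -/w -eMw DM dvdn_exp.
    by rewrite Euclid_dvdX // l0 andbT dvdn_prime2 // eq_sym (negPf neq_qp).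
  have qw : (q <= w)%N by rewrite -[X in (X <= _)%N]expn1 leq_exp2l ?prime_gt1.
  have w0 : (0 < w)%N by exact: leq_ltn_trans Mw.
  have /andP[hF _] := reval_itv R F0 FC hm q_pr.
  have /andP[hG _] := reval_itv R G0 GC hm q_pr.
  rewrite /a /log_factor q_pr; apply: le_trans (ln_diff_le hF hG) _.
  rewrite -revalB (_ : 4 = 2 * 2); last by rewrite -natrM.
  rewrite -!mulrA ler_pM2l //.
  have {}dl := dl.1.
  apply: le_trans (@reval_le _ _ _ l (inv_pow_itv _ _ q_pr) _) _.
    by move=> i /dl; rewrite coefB => ->; rewrite subrr.
  apply: (@le_trans _ _ (2 * (q ^ C)%:R * inv_pow R m q ^+ l)).
    apply: ler_wpM2r; last exact: l1_leR.
    by rewrite exprn_ge0 //; case/andP: (inv_pow_itv R m q_pr).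
  rewrite -mulrA ler_pM2l //.
  rewrite /inv_pow -exprM mulnC exprM.
  have -> : (q%:R^-1 : R) ^+ l = w%:R^-1 by rewrite exprVn -natrX.
  rewrite /m !exprD.
  apply: (@le_trans _ _ ((w ^ C)%:R * (w%:R^-1 ^+ C * w%:R^-1 ^+ 3 * w%:R^-1 ^+ j))).
    apply: ler_wpM2r; last first.
      by rewrite ler_nat; case: (posnP C) => [->|C0]; rewrite ?expn0 ?leq_exp2r.
    by rewrite !mulr_ge0 ?exprn_ge0 ?invr_ge0.
  have wn0 : w%:R != 0 :> R by rewrite pnatr_eq0 -lt0n.
  rewrite !mulrA natrX -exprMn mulfV // expr1n mul1r mulrC.
  apply: ler_pM; rewrite ?exprn_ge0 ?invr_ge0 //.
    by apply: lerXn2r; rewrite ?nnegrE ?invr_ge0 // lef_pV2 ?posrE ?ltr0n // ler_nat.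
  rewrite (_ : _ / _ / _ = w%:R^-1 ^+ 3); last by rewrite !exprS expr0 mulr1 mulrA.
  apply: (@le_trans _ _ (q%:R^-1 ^+ 3)); last exact: (inv_cube_le_pronic R (prime_gt1 q_pr)).
  apply: lerXn2r; rewrite ?nnegrE ?invr_ge0 //.
  by rewrite lef_pV2 ?posrE ?ltr0n ?(prime_gt0 q_pr) // ler_nat.
have main (j : nat) : (M%:R^-1 : R) ^+ (C + 3 + j) <= 4 * `|a F (C + 3 + j) p - a G (C + 3 + j) p|.
  set m := (C + 3 + j)%N; have hm : (C + 3 <= m)%N by exact: leq_addr.
  have /andP[hF hF'] := reval_itv R F0 FC hm p_pr.
  have /andP[hG hG'] := reval_itv R G0 GC hm p_pr.
  have := @ln_diff_ge _ (reval (F p) (inv_pow R m p)) (reval (G p) (inv_pow R m p)).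
  rewrite /a /log_factor p_pr -revalB => H.
  suff H2 : (M%:R^-1 : R) ^+ m <= 2 * `|reval (F p - G p) (inv_pow R m p)|.
    have /H /(_ _) H3 : 0 < reval (F p) (inv_pow R m p) <= 2 by lra.
    have {}H3 := H3 ltac:(lra); lra.
  set t := inv_pow R m p.
  have t01 := inv_pow_itv R m p_pr; have /andP[t0 t1] := t01.
  have tk : (M%:R^-1 : R) ^+ m = t ^+ k.
    by rewrite DM natrX -exprVn /t /inv_pow -!exprM mulnC.
  (* The lowest coefficient [c] is a nonzero integer, so its term has absolute value at least t^k;
     the rest [f] vanishes to order k + 1 and is at most t^k / 2. *)
  pose c := (F p - G p)`_k; pose f := F p - G p - c *: 'X^k.
  have cn0 : 1 <= `|c|%:~R :> R.
    rewrite -[1]/(1%:~R) ler_int -gtz0_ge1 normr_gt0 /c coefB subr_eq0.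
    by apply/eqP; exact: dk.2.
  have fk i : (i < k.+1)%N -> f`_i = 0.
    rewrite ltnS leq_eqVlt => /orP[/eqP->|lt_ik].
      by rewrite /f coefB coefZ coefXn eqxx mulr1 subrr.
    by rewrite /f coefB coefZ coefXn (ltn_eqF lt_ik) mulr0 subr0 coefB dk.1 // subrr.
  have lf : l1norm f <= l1norm (F p - G p).
    apply: l1norm_sub => i; rewrite [f`_i]coefB coefZ coefXn.
    have [->|nik] := eqVneq i k; [right|left]; last by rewrite mulr0 subr0.
    by rewrite mulr1 subrr.
  have ef : reval f t = reval (F p - G p) t - c%:~R * t ^+ k.
    by rewrite [LHS]revalB; congr (_ - _); rewrite /reval map_polyZ map_polyXn hornerZ hornerXn.
  have := reval_le t01 fk; rewrite ef.
  move=> H2.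
  have small : (l1norm f)%:~R * t <= 1/2 :> R.
    apply: (@le_trans _ _ (2 * ((p ^ C)%:R * t))).
      rewrite mulrA; apply: ler_wpM2r => //; apply: (le_trans _ (l1_leR _ p_pr)).
      by rewrite ler_int.
    have /andP[i0 i1] := prime_inv_itv R p_pr.
    have h : (p%:R^-1 : R) ^+ 3 <= 1/4 by rewrite !exprS expr0 mulr1; nra.
    have := @pow_small R C m hm p (p ^ C)%:R p_pr; rewrite ler0n lexx => /(_ isT).
    by rewrite -/t; lra.
  have tk0 : 0 <= t ^+ k by rewrite exprn_ge0.
  rewrite tk; move: H2; rewrite exprS mulrA.
  have : `|c%:~R * t ^+ k| >= t ^+ k :> R.
    by rewrite normrM (ger0_norm tk0) -intr_norm ler_peMl.
  move: (c%:~R * t ^+ k) => X HX H2.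
  have : (l1norm f)%:~R * t * t ^+ k <= 1/2 * t ^+ k by apply: ler_wpM2r.
  have := ler_normB (reval (F p - G p) t) (reval (F p - G p) t - X); rewrite subKr.
  rewrite -/t in H2; lra.
(* The differences of logarithms sum to 0, so the term at p is at most the total of the others;
   [inv_pronic] sums to at most 1, and 16 combines the 4 of [main] with the 4 of [tail]. *)
have bound (j : nat) : (M%:R^-1 : R) ^+ (C + 3 + j) <= 16 * (M.+1%:R^-1) ^+ j.
  apply: le_trans (main j) _; rewrite (_ : 16 = 4 * 4); last by rewrite -natrM.
  rewrite -mulrA ler_pM2l //; set m := (C + 3 + j)%N.
  set e := 4 * _ ^+ j.
  have e0 : 0 <= e by rewrite mulr_ge0 ?exprn_ge0 ?invr_ge0.
  have hm : (C + 3 <= m)%N by exact: leq_addr.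
  apply/ler_addgt0Pr => eps eps0.
  have /cvgrPdist_le /(_ _ eps0) [N _ HN] := sum0 m hm.
  have := HN (maxn N p.+1) (leq_maxl _ _) => /=; rewrite sub0r normrN /series /= big_mkord.
  have lt_p : (p < maxn N p.+1)%N by rewrite leq_max ltnSn orbT.
  rewrite (bigD1 (Ordinal lt_p)) //=; set T := \sum_(i < _ | _) _.
  have HT : `|T| <= e.
    apply: le_trans (ler_norm_sum _ _ _) _.
    apply: (@le_trans _ _ (\sum_(i < maxn N p.+1) e * inv_pronic R i)); last first.
      by rewrite -mulr_sumr ler_piMr // sum_inv_pronic_le.
    rewrite big_mkcond; apply: ler_sum => i _; case: ifP => [ip|_]; last first.
      by rewrite mulr_ge0 // invr_ge0.
    have [i_pr|i_npr] := boolP (prime i).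
      apply: tail => //; apply/eqP => ip'; move/eqP: ip; apply; exact: val_inj.
    by rewrite /a /log_factor (negPf i_npr) subrr normr0 mulr_ge0 // invr_ge0.
  move: (a F m p - a G m p) => X HX.
  have := ler_normB (X + T) T; rewrite addrK; lra.
(* [bound] amounts to (1 + 1/M)^j <= 16 M^(C+3); for this j, Bernoulli's lower bound 1 + j/M exceeds
   the right side by 1. *)
pose j := (16 * M ^ (C + 4))%N.
have Mp : 0 < M%:R :> R by rewrite ltr0n.
have bern n : 1 + M%:R^-1 * n%:R <= (1 + M%:R^-1) ^+ n :> R.
  elim: n => [|n IH]; first by rewrite mulr0 addr0 expr0.
  have i0 : 0 < M%:R^-1 :> R by rewrite invr_gt0.
  rewrite exprS -natr1; have n0 : 0 <= n%:R :> R by [].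
  move: (_ ^+ n) IH => X; nra.
have := bound j; rewrite -[M.+1%:R]natr1.
have -> : M%:R + 1 = M%:R * (1 + M%:R^-1) :> R by rewrite mulrDr mulr1 mulfV ?gt_eqF.
rewrite exprD !exprVn exprMn invfM [leLHS]mulrC [leRHS]mulrCA ler_pM2l ?invr_gt0 ?exprn_gt0 //.
have Xp : 0 < (1 + M%:R^-1) ^+ j :> R by rewrite exprn_gt0 // addr_gt0 ?invr_gt0.
rewrite ler_pdivlMr // mulrC ler_pdivrMr ?exprn_gt0 //.
apply/negP; rewrite -ltNge; apply: lt_le_trans (bern j).
have -> : M%:R^-1 * j%:R = 16 * M%:R ^+ (C + 3) :> R.
  rewrite /j natrM natrX (addnS C 3) exprS mulrCA; congr (_ * _).
  by rewrite mulKf ?gt_eqF.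
by rewrite ltrDr.
Qed.

(** * Euler factors of twisted L-series *)

Definition euler_factor (K : fieldExtType rat) (iota : {rmorphism K -> algC})
    (E : weierstrass K) (chi : quad_char iota) (p : nat) : {poly int} :=
  \prod_(P <- fset_set (primes_above K p)) twisted_local_factor E chi p P.

(** An exponent: each factor above p has norm at most 1 + N^2 + N <= 4 N^2 <= p^(2 dim + 2), and
    there are at most dim primes above p. *)
Definition euler_bound (K : fieldExtType rat) : nat :=
  ((2 * \dim {:K} + 2) * \dim {:K})%N.

Section EulerFactor.
Variables (K : fieldExtType rat) (iota : {rmorphism K -> algC}).
Variables (E : weierstrass K) (chi : quad_char iota) (p : nat).
Hypothesis p_pr : prime p.

Lemma l1norm_trinomial (f : nat) (a b : int) :
  l1norm (1 + a *: 'X^f + b *: 'X^(2 * f)) <= 1 + `|a| + `|b|.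
Proof.
apply: le_trans (l1normD _ _) _; rewrite l1normZ l1normXn mulr1 lerD2r.
by apply: le_trans (l1normD _ _) _; rewrite l1normZ l1normXn mulr1 -(expr0 'X) l1normXn.
Qed.

Lemma trinomial_horner0 (f : nat) (a b : int) : (0 < f)%N ->
  (1 + a *: 'X^f + b *: 'X^(2 * f)).[0] = 1.
Proof.
by move=> f0; rewrite !hornerE !expr0n muln_eq0 /= -(negbK (f == 0)%N) -lt0n f0 !mulr0 !addr0.
Qed.

(** One shape for good and bad reduction, so that uniqueness of Euler products applies to all
    rational primes at once. *)
Lemma twisted_factorE (P : set K) : primes_above K p P -> exists a b : int,
  [/\ `|a| <= (norm_ideal P ^ 2)%:Z, `|b| <= (norm_ideal P)%:Z &
  twisted_local_factor E chi p P =
    1 + a *: 'X^(inertia_degree p P) + b *: 'X^(2 * inertia_degree p P)].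
Proof.
move=> PP; have [_ NE] := norm_ideal_expE p_pr PP.
rewrite /twisted_local_factor; case: asboolP => _; last first.
  rewrite /local_factor; case: asboolP => _.
    exists (ap (quadratic_twist E (char_radicand chi)) P), (p ^ inertia_degree p P)%:Z.
    by split=> //; [exact: (ap_le p_pr PP)|rewrite -NE].
  exists (ap (quadratic_twist E (char_radicand chi)) P), 0; rewrite scale0r normr0.
  by split=> //; exact: (ap_le p_pr PP).
exists (char_at chi P * ap E P), (char_at chi P ^+ 2 * (p ^ inertia_degree p P)%:Z).
have apl := ap_le p_pr PP E; rewrite -NE.
split=> //; case: (char_at_pm chi P) => ->;
  by rewrite ?mul0r ?normr0 ?expr0n ?mul1r ?mulN1r ?normrN ?sqrrN ?expr1n ?mul1r ?mul0r ?normr0.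
Qed.

Lemma l1norm_twisted (P : set K) : primes_above K p P ->
  l1norm (twisted_local_factor E chi p P) <= (p ^ (2 * \dim {:K} + 2))%:Z.
Proof.
move=> PP; have [a [b [ha hb ->]]] := twisted_factorE PP.
apply: le_trans (l1norm_trinomial _ _ _) _.
have [/andP[_ fd] NE] := norm_ideal_expE p_pr PP.
have N1 := norm_ideal_gt1 p_pr PP; have p1 := prime_gt1 p_pr.
have h1 : (norm_ideal P ^ 2 <= p ^ (2 * \dim {:K}))%N.
  by rewrite NE -expnM mulnC leq_exp2l // leq_pmul2l.
have h2 : (1 + norm_ideal P ^ 2 + norm_ideal P <= p ^ (2 * \dim {:K} + 2))%N.
  have p4 : (4 <= p ^ 2)%N by rewrite -[4%N]/(2 ^ 2)%N leq_exp2r.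
  rewrite expnD; apply: leq_trans (leq_mul h1 p4).
  by move: (norm_ideal P) N1 => N; rewrite -mulnn; nia.
apply: (@le_trans _ _ (1 + norm_ideal P ^ 2 + norm_ideal P)%N%:Z); last by rewrite lez_nat.
by rewrite !PoszD -addrA -[leRHS]addrA lerD2l lerD.
Qed.

Lemma l1norm_euler_factor : l1norm (euler_factor E chi p) <= (p ^ euler_bound K)%:Z.
Proof.
have fin := finite_primes_above K p_pr.
pose f P := if `[< primes_above K p P >] then twisted_local_factor E chi p P else 1.
have -> : euler_factor E chi p = \prod_(P <- fset_set (primes_above K p)) f P.
  rewrite /euler_factor big_seq [RHS]big_seq; apply: eq_bigr => P.
  by rewrite in_fset_set // => /set_mem PP; rewrite /f asboolT.
apply: (@le_trans _ _ ((p ^ (2 * \dim {:K} + 2))%:Z ^+ size (fset_set (primes_above K p)))).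
  apply: l1norm_prod => // P; rewrite /f; case: asboolP => [|_]; first exact: l1norm_twisted.
  by rewrite -(expr0 'X) l1normXn lez_nat expn_gt0 prime_gt0.
rewrite -natz -natrX natz lez_nat /euler_bound expnM leq_exp2l //.
  apply: (size_primes_above p_pr); first exact: fset_uniq.
  by move=> Q; rewrite in_fset_set // => /set_mem.
by rewrite -{1}(expn0 p) ltn_exp2l ?prime_gt1 // addn2.
Qed.

Lemma euler_factor0 : (euler_factor E chi p)`_0 = 1.
Proof.
have fin := finite_primes_above K p_pr.
rewrite -horner_coef0 /euler_factor horner_prod big_seq big1 // => P.
rewrite in_fset_set // => /set_mem PP; have [a [b [_ _ ->]]] := twisted_factorE PP.
by rewrite trinomial_horner0 //; have [/andP[]] := norm_ideal_expE p_pr PP.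
Qed.

End EulerFactor.

(** * L-series at large integers s *)

Section ComplexValues.
Variable R : realType.

Lemma npow_opp_nat (p m : nat) : prime p ->
  npow_opp p (m%:R : R[i]) = (inv_pow R m p)%:C%C.
Proof.
move=> p_pr; have p0 : 0 < p%:R :> R by rewrite ltr0n prime_gt0.
rewrite /npow_opp -(rmorph_nat (real_complex R)) /= mul0r cos0 sin0.
have -> : (1 -i* 0)%C = 1 :> R[i] by rewrite oppr0.
rewrite mulr1; congr (_%:C)%C.
by rewrite expRN expRM_natl lnK ?posrE // /inv_pow exprVn.
Qed.

Lemma horner_real_complex (f : {poly int}) (x : R) :
  (map_poly intr f).[x%:C%C] = (reval f x)%:C%C :> R[i].
Proof.
rewrite /reval -[RHS](horner_map (real_complex R)) -map_poly_comp; congr (_.[_]).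
by apply: eq_map_poly => a /=; rewrite rmorph_int.
Qed.

Lemma euler_product_nat (K : fieldExtType rat) (iota : {rmorphism K -> algC})
    (E : weierstrass K) (chi : quad_char iota) (m N : nat) :
  euler_product E chi (m%:R : R[i]) N =
  (\prod_(p < N | prime p) (reval (euler_factor E chi p) (inv_pow R m p))^-1)%:C%C.
Proof.
rewrite /euler_product rmorph_prod; apply: eq_bigr => p p_pr.
rewrite fsbig_finite; last exact: finite_primes_above.
rewrite prodfV fmorphV /=; congr (_^-1).
rewrite npow_opp_nat // -horner_real_complex /euler_factor rmorph_prod horner_prod.
by [].
Qed.

Lemma cvg_real_complex (u : nat -> R) (l : R) : u @ \oo --> l ->
  ((fun n => (u n)%:C%C : R[i]^o) @ \oo --> (l%:C%C : R[i]^o)).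
Proof.
move=> ul; apply/cvgrPdist_le => eps eps0.
have [e e0 De] : exists2 e : R, 0 < e & eps = e%:C%C.
  exists (complex.Re eps); first by move: eps0; rewrite ltcE => /andP[].
  by case: eps eps0 => a b; rewrite ltcE /= => /andP[/eqP -> _].
move/cvgrPdist_le: ul => /(_ e e0); apply: filterS => n H.
rewrite -rmorphB normc_def /= expr0n addr0 sqrtr_sqr De lecR.
exact: H.
Qed.

(** At such m the partial products are real and converge, so the [lim] defining [Lseries] is a
    genuine limit and can be taken in R. *)
Lemma Lseries_nat (K : fieldExtType rat) (iota : {rmorphism K -> algC})
    (E : weierstrass K) (chi : quad_char iota) (m : nat) :
  (euler_bound K + 3 <= m)%N -> Lseries E chi (m%:R : R[i]) =
  (lim ((fun N => \prod_(p < N | prime p)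
     (reval (euler_factor E chi p) (inv_pow R m p))^-1) @ \oo))%:C%C.
Proof.
move=> hm.
have F0 q := @euler_factor0 K iota E chi q.
have FC q := @l1norm_euler_factor K iota E chi q.
have cv := cvg_prod (R := R) F0 FC hm.
rewrite /Lseries (cvg_lim (@norm_hausdorff _ _) cv).
have -> : (fun N => euler_product E chi (m%:R : R[i]) N : R[i]^o) = (fun N =>
    (\prod_(p < N | prime p) (reval (euler_factor E chi p) (inv_pow R m p))^-1)%:C%C).
  by apply/funext => N; rewrite euler_product_nat.
exact: (cvg_lim (@norm_hausdorff _ R[i]^o) (cvg_real_complex cv)).
Qed.

Lemma euler_factor_eq (K K' : fieldExtType rat)
    (iota : {rmorphism K -> algC}) (iota' : {rmorphism K' -> algC})
    (E : weierstrass K) (E' : weierstrass K')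
    (chi : quad_char iota) (chi' : quad_char iota') :
  (forall s : R[i], 3 / 2 < complex.Re s -> Lseries E chi s = Lseries E' chi' s) ->
  forall p, prime p -> euler_factor E chi p = euler_factor E' chi' p.
Proof.
move=> hL; pose C := (euler_bound K + euler_bound K')%N.
apply: (@euler_product_inj R _ _ C).
- exact: euler_factor0.
- exact: euler_factor0.
- move=> q q_pr; apply: le_trans (l1norm_euler_factor _ _ q_pr) _.
  by rewrite lez_nat leq_exp2l ?prime_gt1 // leq_addr.
- move=> q q_pr; apply: le_trans (l1norm_euler_factor _ _ q_pr) _.
  by rewrite lez_nat leq_exp2l ?prime_gt1 // leq_addl.
move=> m hm; apply: (@complexI R).
rewrite -!Lseries_nat; first (apply: hL).
- rewrite -(rmorph_nat (real_complex R)) /= ltr_pdivrMr // -natrM ltr_nat.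
  by move: hm; rewrite /C; lia.
- by apply: leq_trans hm; rewrite leq_add2r leq_addl.
- by apply: leq_trans hm; rewrite leq_add2r leq_addr.
Qed.

End ComplexValues.

(** * Matching the primes above p *)

(** Artin's argument, with repeated characters allowed: the relation at x0 x minus e_j(x0) times the
    relation at x removes j, and it multiplies every coefficient in the class of [e0] by the same
    nonzero constant e0(x0) - e_j(x0). When only that class is left, evaluate at [one]. *)
Lemma char_independence (R : idomainType) (X : Type) (mul : X -> X -> X) (one : X)
    (X0 : set X) (I : eqType) (e : I -> X -> int) (e0 : X -> int) (s : seq I) (c : I -> R) :
  injective (intr : int -> R) ->
  X0 one -> (forall x y, X0 x -> X0 y -> X0 (mul x y)) -> e0 one = 1 ->
  (forall i, i \in s -> forall x y, X0 x -> X0 y -> e i (mul x y) = e i x * e i y) ->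
  (forall x, X0 x -> \sum_(i <- s) c i * (e i x)%:~R = 0) ->
  \sum_(i <- s | `[< forall x, X0 x -> e i x = e0 x >]) c i = 0.
Proof.
move=> inj X01 X0M e01.
have [n] := ubnP (size s); elim: n => // n IHn in s c *; rewrite ltnS => szn eM rel.
have [allag|] := pselect (forall i, i \in s -> forall x, X0 x -> e i x = e0 x).
  have := rel _ X01; rewrite big_seq_cond => H; rewrite big_seq_cond -[RHS]H.
  apply: eq_big => [i|i /andP[iS _]]; last by rewrite (allag i iS _ X01) e01 mulr1.
  by rewrite andbT; apply: andb_idr => /allag H'; apply/asboolP.
move=> /existsNP[j /not_implyP[js /existsNP[x0 /not_implyP[X0x0 nag]]]].
have ps := perm_to_rem js; set s' := rem j s in ps.
pose c' i := c i * ((e i x0)%:~R - (e j x0)%:~R).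
have s's i : i \in s' -> i \in s by exact: mem_rem.
have IH : \sum_(i <- s' | `[< forall x, X0 x -> e i x = e0 x >]) c' i = 0.
  apply: IHn.
  - by apply: leq_trans szn; rewrite (perm_size ps).
  - by move=> i /s's; exact: eM.
  - move=> x X0x.
    have : \sum_(i <- s) c' i * (e i x)%:~R = 0.
      rewrite (_ : \sum_(i <- s) _ = \sum_(i <- s) c i * (e i (mul x0 x))%:~R
         - (e j x0)%:~R * \sum_(i <- s) c i * (e i x)%:~R); last first.
        rewrite mulr_sumr -sumrB; apply: eq_big_seq => i iS.
        by rewrite eM // intrM /c'; ring.
      by rewrite !rel // ?mulr0 ?subrr //; exact: X0M.
    by rewrite (perm_big _ ps) big_cons /= {1}/c' subrr mulr0 mul0r add0r.
have nz : (e0 x0)%:~R - (e j x0)%:~R != 0 :> R.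
  by rewrite subr_eq0; apply/eqP => /inj /esym.
rewrite (perm_big _ ps) big_cons asboolF; last by move=> /(_ _ X0x0).
apply: (mulfI nz); rewrite mulr0 -[RHS]IH mulr_sumr.
by apply: eq_bigr => i /asboolP ag; rewrite /c' ag // mulrC.
Qed.

(** For the least exponent m that occurs, the coefficient of T^(2m) is p^m times the multiplicity of
    m; hence m occurs on both sides and one factor can be cancelled. *)
Lemma binomial_prod_perm (p : nat) (s s' : seq nat) : (0 < p)%N ->
  (forall f, f \in s -> (0 < f)%N) -> (forall f, f \in s' -> (0 < f)%N) ->
  \prod_(f <- s) (1 + (p ^ f)%:Z *: 'X^(2 * f)) =
  \prod_(f <- s') (1 + (p ^ f)%:Z *: 'X^(2 * f)) :> {poly int} -> perm_eq s s'.
Proof.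
move=> p0; pose F (f : nat) : {poly int} := 1 + (p ^ f)%:Z *: 'X^(2 * f).
have F0 f : (0 < f)%N -> (F f)`_0 = 1.
  by case: f => // f _; rewrite coefD coefZ coefXn coef1 mulr0 addr0.
have G0 s1 : (forall f, f \in s1 -> (0 < f)%N) -> (\prod_(f <- s1) F f)`_0 = 1.
  move=> pos; rewrite -horner_coef0 horner_prod big_seq big1 // => f /pos f0.
  by rewrite horner_coef0 F0.
have coefG m s1 : (0 < m)%N -> (forall f, f \in s1 -> (m <= f)%N) ->
    (\prod_(f <- s1) F f)`_(2 * m) = (count_mem m s1)%:Z * (p ^ m)%:Z.
  move=> m0; elim: s1 => [|f s1 IH] ge_m.
    by rewrite big_nil coef1 muln_eq0 /= -(negbK (m == 0)%N) -lt0n m0 mul0r.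
  have ge_m1 g : g \in s1 -> (m <= g)%N by move=> g1; apply: ge_m; rewrite inE g1 orbT.
  rewrite big_cons mulrDl mul1r coefD IH // -scalerAl coefZ coefXnM ltn_mul2l /=.
  have := ge_m f (mem_head _ _); rewrite leq_eqVlt => /orP[/eqP <-|lt_mf].
    rewrite ltnn subnn G0 ?mulr1 ?eqxx /=; first by rewrite add1n -addn1 PoszD mulrDl mul1r.
    by move=> g /ge_m1; exact: leq_trans.
  by rewrite lt_mf mulr0 addr0 (gtn_eqF lt_mf) add0n.
rewrite -/F; have [n] := ubnP (size s + size s'); elim: n => // n IHn in s s' *.
rewrite ltnS => szn pos pos' eqG.
have [/eqP|ne] := boolP (s ++ s' == [::]).
  by move/eqP; case: s {szn pos eqG} => //; case: s' {pos'}.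
have exm : exists m, m \in s ++ s'.
  by move: ne; case: (s ++ s') => // m r _; exists m; rewrite mem_head.
case: (ex_minnP exm) => m ms mmin.
have m0 : (0 < m)%N by move: ms; rewrite mem_cat => /orP[/pos|/pos'].
have ge_s f : f \in s -> (m <= f)%N by move=> fs; apply: mmin; rewrite mem_cat fs.
have ge_s' f : f \in s' -> (m <= f)%N by move=> fs; apply: mmin; rewrite mem_cat fs orbT.
have ecnt : count_mem m s = count_mem m s'.
  have := congr1 (fun q : {poly int} => q`_(2 * m)) eqG; rewrite /= !coefG //.
  by move/(mulIf _); rewrite eqz_nat -lt0n expn_gt0 p0 => /(_ isT) [].
have m_s : m \in s.
  move: ms; rewrite mem_cat => /orP[//|]; rewrite -!has_pred1 !has_count.
  by rewrite ecnt.
have m_s' : m \in s' by rewrite -has_pred1 has_count -ecnt -has_count has_pred1.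
have ps := perm_to_rem m_s; have ps' := perm_to_rem m_s'.
apply: (perm_trans ps); rewrite perm_sym; apply: (perm_trans ps').
rewrite perm_sym perm_cons; apply: IHn.
- move: szn; rewrite (perm_size ps) (perm_size ps') /= addSn addnS.
  by move=> h; apply: leq_trans h; rewrite ltnS leqnSn.
- by move=> f /mem_rem /pos.
- by move=> f /mem_rem /pos'.
have Fm0 : F m != 0 by apply/eqP => e; have := F0 m m0; rewrite e coef0.
by apply: (mulfI Fm0); move: eqG; rewrite (perm_big _ ps) (perm_big _ ps') !big_cons.
Qed.

(** Partners with equal keys are chosen one at a time and removed; [x0] fills in the values outside
    [A]. *)
Lemma perm_map_bij (T T' U : eqType) (x0 : T') (k : T -> U) (k' : T' -> U) A B :
  uniq A -> uniq B -> perm_eq (map k A) (map k' B) -> exists g : T -> T',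
  [/\ forall x, x \in A -> g x \in B /\ k' (g x) = k x, {in A &, injective g}
    & forall y, y \in B -> exists2 x, x \in A & g x = y].
Proof.
elim: A B => [|a A IH] B /= uA uB pAB.
  exists (fun=> x0); split=> //; have := perm_size pAB; rewrite size_map.
  by case: B {uB pAB}.
have /andP[aA {}uA] := uA.
have /mapP[b bB kb] : k a \in map k' B by rewrite -(perm_mem pAB) mem_head.
have pB := perm_to_rem bB.
have [||g [gP gi gs]] := IH (rem b B) uA; first exact: rem_uniq.
  by rewrite -(perm_cons (k a)); apply: perm_trans pAB _; rewrite kb; exact: (perm_map k' pB).
have gE x : x \in A -> (if x == a then b else g x) = g x.
  by move=> xA; case: eqP => // xa; rewrite -xa xA in aA.
have gb x : x \in A -> g x != b.
  by move=> /gP[]; rewrite mem_rem_uniq // inE => /andP[].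
exists (fun x => if x == a then b else g x); split.
- move=> x; rewrite inE => /orP[/eqP->|xA]; first by rewrite eqxx.
  by rewrite gE //; have [gB gk] := gP x xA; split=> //; exact: mem_rem gB.
- move=> x y; rewrite !inE => /orP[/eqP->|xA] /orP[/eqP->|yA] //; rewrite ?eqxx ?gE //.
  + by move=> e; have := gb y yA; rewrite -e eqxx.
  + by move=> e; have := gb x xA; rewrite e eqxx.
  + exact: gi.
- move=> y yB; have [->|yb] := eqVneq y b; first by exists a; rewrite ?mem_head ?eqxx.
  have /gs[x xA gx] : y \in rem b B by rewrite mem_rem_uniq // inE yb.
  by exists x; rewrite ?gE // inE xA orbT.
Qed.

Lemma poly_zero_near0 (R : realType) (q : {poly R}) (delta : R) : 0 < delta ->
  (forall t, 0 < t <= delta -> q.[t] = 0) -> q = 0.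
Proof.
move=> d0 q0; apply/eqP/negPn/negP => qn0.
pose rs := [seq delta / i.+1%:R | i <- iota 0 (size q)].
have ur : uniq rs.
  rewrite map_inj_uniq ?iota_uniq // => i j /(mulfI (lt0r_neq0 d0)) /invr_inj /eqP.
  by rewrite eqr_nat => /eqP [].
have ar : all (root q) rs.
  apply/allP => _ /mapP[i _ ->]; apply/rootP/q0; rewrite divr_gt0 //=.
  rewrite ler_pdivrMr //; apply: ler_peMr; [exact: ltW|by rewrite ler1n].
by have := max_poly_roots qn0 ar ur; rewrite size_map size_iota ltnn.
Qed.

Definition trinomial (p : nat) (c a : int) (f : nat) : {poly int} :=
  1 + (c * a) *: 'X^f + (c ^+ 2 * (p ^ f)%:Z) *: 'X^(2 * f).

Definition sign0 (c : int) : Prop := [\/ c = 0, c = 1 | c = -1].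

Lemma size_trinomial p c a f : (0 < p)%N -> (0 < f)%N -> sign0 c ->
  size (trinomial p c a f) = (if c != 0 then (2 * f) else 0).+1.
Proof.
move=> p0 f0.
have main (b : int) : size (1 + b *: 'X^f + (p ^ f)%:Z *: 'X^(2 * f)) = (2 * f).+1.
  have sz : size ((p ^ f)%:Z *: 'X^(2 * f) : {poly int}) = (2 * f).+1.
    by rewrite size_scale ?size_polyXn // eqz_nat -lt0n expn_gt0 p0.
  rewrite addrC size_polyDl sz // ltnS.
  apply: (leq_trans (size_polyD _ _)); rewrite geq_max size_poly1 muln_gt0 f0 /=.
  apply: (leq_trans (size_scale_leq _ _)); rewrite size_polyXn.
  by rewrite -{1}(mul1n f) ltn_mul2r f0.
rewrite /trinomial => -[->|->|->].
- by rewrite expr0n !mul0r !scale0r !addr0 size_poly1.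
- by rewrite expr1n !mul1r main.
- by rewrite sqrrN expr1n mul1r main.
Qed.

(** * Even and odd parts of the logarithm of a factor *)

Section Trinomial.
Variables (R : realType) (p : nat).
Hypothesis p0 : (0 < p)%N.
Implicit Types (a c : int) (f : nat) (t : R).

Lemma reval_trinomial c a f t : reval (trinomial p c a f) t =
  1 + (c * a)%:~R * t ^+ f + (c ^+ 2)%:~R * ((p ^ f)%:R * t ^+ (2 * f)).
Proof.
rewrite /reval /trinomial !rmorphD rmorph1 /= !map_polyZ !map_polyXn !hornerE.
by rewrite /= (intrM _ (c ^+ 2)).
Qed.

(** The bound keeps the middle term within 1/2, so the factors for c = 1 and c = -1 are both
    positive and have logarithms. *)
Definition small_at a t : Prop := 0 < t <= 1 /\ `|a|%:~R * t <= 1/2.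

Lemma small_delta (l : seq int) :
  exists2 d : R, 0 < d & forall a, a \in l -> forall t, 0 < t <= d -> small_at a t.
Proof.
suff [d /andP[d0 d1] dl] : exists2 d : R, 0 < d <= 1 & forall a, a \in l -> `|a|%:~R * d <= 1/2.
  exists d => // a al t /andP[t0 td]; split; first by rewrite t0 (le_trans td).
  by apply: le_trans (dl _ al); rewrite ler_wpM2l // ler0z.
elim: l => [|a l [d /andP[d0 d1] IH]]; first by exists 1 => //; rewrite ltr01 lexx.
have A0 : 0 <= `|a|%:~R :> R by rewrite ler0z.
have B0 : 0 < 2 * (`|a|%:~R + 1) :> R by rewrite mulr_gt0 // ltr_wpDl.
exists (Num.min d (2 * (`|a|%:~R + 1))^-1).
  by rewrite lt_min d0 invr_gt0 B0 ge_min d1.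
move=> b; rewrite inE => /orP[/eqP->|bl].
  apply: (@le_trans _ _ (`|a|%:~R * (2 * (`|a|%:~R + 1))^-1)).
    by rewrite ler_wpM2l // ge_min lexx orbT.
  by rewrite ler_pdivrMr //; lra.
by apply: le_trans (IH _ bl); rewrite ler_wpM2l ?ler0z // ge_min lexx.
Qed.

Lemma trinomial_gt0 c a f t : (0 < f)%N -> sign0 c -> small_at a t ->
  0 < reval (trinomial p c a f) t.
Proof.
move=> f0 c_pm [/andP[t0 t1] at2]; rewrite reval_trinomial.
have h1 : 0 <= (c ^+ 2)%:~R * ((p ^ f)%:R * t ^+ (2 * f)).
  have t0' := ltW t0; apply: mulr_ge0; first by rewrite ler0z sqr_ge0.
  by rewrite mulr_ge0 ?exprn_ge0.
have h2 : `|(c * a)%:~R * t ^+ f| <= 1/2.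
  apply: le_trans at2; rewrite normrM -intr_norm normrM normrX (gtr0_norm t0).
  apply: (@le_trans _ _ (`|a|%:~R * t ^+ f)).
    apply: ler_wpM2r; first by rewrite exprn_ge0 // ltW.
    by rewrite ler_int ler_piMl //; case: c_pm => ->.
  apply: ler_wpM2l; first by rewrite ler0z.
  by rewrite -{2}(expr1 t) ler_wiXn2l // ltW.
by move: h2; rewrite ler_norml => /andP[]; lra.
Qed.

Definition evenlog a f t : R :=
  (ln (reval (trinomial p 1 a f) t) + ln (reval (trinomial p (-1) a f) t)) / 2.
Definition oddlog a f t : R :=
  (ln (reval (trinomial p 1 a f) t) - ln (reval (trinomial p (-1) a f) t)) / 2.

(** Interpolation on 0, 1, -1: a function vanishing at c = 0 is c^2 times its even part plus c times
    its odd part, and h^2 = 1. *)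
Lemma ln_trinomial c h a f t : sign0 c -> h = 1 \/ h = -1 ->
  ln (reval (trinomial p (c * h) a f) t) =
  (c ^+ 2)%:~R * evenlog a f t + c%:~R * oddlog a f t * h%:~R.
Proof.
move=> [->|->|->] hpm.
- by rewrite mul0r reval_trinomial expr0n /= !mul0r !addr0 ln1.
- case: hpm => ->; rewrite /evenlog /oddlog ?mul1r ?mulr1 ?expr1n ?rmorphN ?rmorph1 /=; by field.
- case: hpm => ->; rewrite /evenlog /oddlog ?mulN1r ?opprK ?sqrrN ?expr1n ?rmorphN ?rmorph1 /=; by field.
Qed.

(** Write the two factors for c = 1, -1 as u + w, u - w and u' + w', u' - w'. Equality of odd parts
    says (u + w)(u' - w') = (u' + w')(u - w), that is w u' = w' u. *)
Lemma oddlog_cross a f a' f' t : (0 < f)%N -> (0 < f')%N ->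
  small_at a t -> small_at a' t -> oddlog a f t = oddlog a' f' t ->
  a%:~R * t ^+ f * (1 + (p ^ f')%:R * t ^+ (2 * f')) =
  a'%:~R * t ^+ f' * (1 + (p ^ f)%:R * t ^+ (2 * f)).
Proof.
move=> f0 f0' sa sa'.
have s1 : sign0 1 by constructor 2. have sN1 : sign0 (-1) by constructor 3.
have v1 := trinomial_gt0 f0 s1 sa; have v2 := trinomial_gt0 f0 sN1 sa.
have v3 := trinomial_gt0 f0' s1 sa'; have v4 := trinomial_gt0 f0' sN1 sa'.
rewrite /oddlog => /(mulIf _) e.
have {e} : ln (reval (trinomial p 1 a f) t * reval (trinomial p (-1) a' f') t) =
   ln (reval (trinomial p 1 a' f') t * reval (trinomial p (-1) a f) t).
  by rewrite !lnM ?posrE //; have := e ltac:(by rewrite invr_eq0 pnatr_eq0); lra.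
move/(ln_inj _ _); rewrite !posrE !mulr_gt0 // => /(_ isT isT).
rewrite !reval_trinomial !sqrrN !expr1n !rmorph1 !mul1r !mulN1r !rmorphN !mulNr.
move: (_%:R * _) (_%:R * t ^+ (2 * f')) => u u'.
move: (a%:~R * _) (a'%:~R * _) => w w'; lra.
Qed.

(** Comparison with a' = 0, whose odd part is 0, would make a t^f times a positive number vanish. *)
Lemma oddlog_neq0 a f t : (0 < f)%N -> small_at a t -> a != 0 -> oddlog a f t != 0.
Proof.
move=> f0 sa a0; apply/eqP => o0.
have s0 : small_at 0 t by case: sa => h _; split=> //; rewrite normr0 mul0r; lra.
have := @oddlog_cross a f 0 f t f0 f0 sa s0.
have od0 : oddlog 0 f t = 0 by rewrite /oddlog /trinomial !mulr0 subrr mul0r.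
rewrite o0 od0 mulr0z !mul0r => /(_ erefl) /eqP.
have /andP[t0 _] := sa.1.
rewrite !mulf_eq0 intr_eq0 (negPf a0) expf_eq0 (gt_eqF t0) andbF /= gt_eqF //.
by rewrite ltr_wpDr // mulr_ge0 // exprn_ge0 // ltW.
Qed.

(** The cross relation is polynomial in t and holds on an interval, hence identically. As f differs
    from f + 2 f' and f' + 2 f, its coefficient at T^f forces f' = f and a' = a. *)
Lemma oddlog_inj a f a' f' (d : R) : (0 < f)%N -> (0 < f')%N -> a != 0 -> 0 < d ->
  (forall t, 0 < t <= d -> small_at a t /\ small_at a' t) ->
  (forall t, 0 < t <= d -> oddlog a f t = oddlog a' f' t) -> a' = a /\ f' = f.
Proof.
move=> f0 f0' a0 d0 sm eqo.
pose q : {poly R} := a%:~R *: 'X^f + (a%:~R * (p ^ f')%:R) *: 'X^(f + 2 * f')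
   - (a'%:~R *: 'X^f' + (a'%:~R * (p ^ f)%:R) *: 'X^(f' + 2 * f)).
have q0 : q = 0.
  apply: (poly_zero_near0 d0) => t td; have [sa sa'] := sm t td.
  have := oddlog_cross f0 f0' sa sa' (eqo t td).
  by rewrite /q !hornerE !exprD => e; move: e; rewrite !mulrDr !mulr1 !mulrA; lra.
have := congr1 (fun r : {poly R} => r`_f) q0.
have e1 : (f == f + 2 * f')%N = false by apply/eqP; lia.
have e2 : (f == f' + 2 * f)%N = false by apply/eqP; lia.
rewrite /q !(coefB, coefD, coefZ, coefXn, coef0) eqxx e1 e2 !mulr0 !addr0 mulr1.
have [->|_] := eqVneq f f'; last by move/eqP; rewrite mulr0 subr0 intr_eq0 (negPf a0).
by rewrite mulr1 => /eqP; rewrite subr_eq0 => /eqP /intr_inj ->.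
Qed.

End Trinomial.

(** The primes above p in one field, with their a, f and character values. [X] will be the
    characters of K for both fields, so that the two families can be compared. *)
Record factor_family (X : Type) := FactorFamily {
  ff_index : eqType;
  ff_seq : seq ff_index;
  ff_a : ff_index -> int;
  ff_f : ff_index -> nat;
  ff_e : X -> ff_index -> int }.

Section Matching.
Variables (R : realType) (p : nat) (X : Type) (mul : X -> X -> X) (one : X).
Hypothesis p0 : (0 < p)%N.
Implicit Types (D : factor_family X) (x y : X) (t : R).

Definition ff_poly D x : {poly int} :=
  \prod_(i <- ff_seq D) trinomial p (ff_e x i) (ff_a i) (ff_f i).

(** Multiplicativity asks that the second character be unramified at i, because two ramified
    characters may have an unramified product. *)
Definition ff_axioms D : Prop :=
  [/\ uniq (ff_seq D), forall i : ff_index D, i \in ff_seq D -> (0 < ff_f i)%N,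
      forall (i : ff_index D), i \in ff_seq D ->
        (forall x, sign0 (ff_e x i)) /\ ff_e one i = 1,
      forall (i : ff_index D) x y, i \in ff_seq D -> ff_e y i != 0 ->
        ff_e (mul x y) i = ff_e x i * ff_e y i
    & forall i : ff_index D, i \in ff_seq D -> exists x, ff_e x i = -1 /\
        forall j, j \in ff_seq D -> j != i -> ff_e x j = 1].

Definition ff_unit D : set X :=
  [set x | forall i : ff_index D, i \in ff_seq D -> ff_e x i != 0].

Lemma size_ff_poly D x : ff_axioms D -> size (ff_poly D x) =
  (\sum_(i <- ff_seq D) if ff_e x i != 0 then (2 * ff_f i)%N else 0%N).+1.
Proof.
move=> [_ fpos epm _ _]; rewrite /ff_poly; move: (ff_seq D) fpos epm => s.
elim: s => [|i s IH] fpos epm; first by rewrite !big_nil size_poly1.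
have {}IH : size (\prod_(i <- s) trinomial p (ff_e x i) (ff_a i) (ff_f i)) =
    (\sum_(i <- s) if ff_e x i != 0 then (2 * ff_f i)%N else 0%N).+1.
  by apply: IH => j js; [apply: fpos|apply: epm]; rewrite inE js orbT.
have sz := size_trinomial (ff_a i) p0 (fpos _ (mem_head _ _)) ((epm _ (mem_head _ _)).1 x).
rewrite !big_cons size_proper_mul; last first.
  by rewrite mulf_neq0 // lead_coef_eq0 -size_poly_eq0 ?sz ?IH.
by rewrite sz IH addSn addnS.
Qed.

(** A ramified index contributes 0 instead of 2 f to the degree. Evaluation at [one] shows that both
    families have the same maximal degree, which only units attain. *)
Lemma ff_unit_sub D D' : ff_axioms D -> ff_axioms D' ->
  (forall x, ff_poly D x = ff_poly D' x) -> ff_unit D `<=` ff_unit D'.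
Proof.
move=> aD aD' eqDD x ux j js; apply/negP => /eqP ej0.
have := congr1 (fun q : {poly int} => size q) (eqDD x).
have := congr1 (fun q : {poly int} => size q) (eqDD one).
rewrite !size_ff_poly // => -[e1] -[e2].
have h (D1 : factor_family X) : ff_axioms D1 ->
    \sum_(i <- ff_seq D1) (if ff_e one i != 0 then (2 * ff_f i)%N else 0%N)
    = \sum_(i <- ff_seq D1) (2 * ff_f i)%N.
  by move=> [_ _ pm _ _]; apply: eq_big_seq => i /pm[_ ->].
rewrite !h // in e1.
have e3 : \sum_(i <- ff_seq D) (if ff_e x i != 0 then (2 * ff_f i)%N else 0%N)
    = \sum_(i <- ff_seq D) (2 * ff_f i)%N.
  by apply: eq_big_seq => i /ux ->.
rewrite e3 e1 in e2; have [uD' fpos _ _ _] := aD'.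
move: e2; rewrite !(bigD1_seq j) //= ej0 eqxx /= add0n => e2.
have : (\sum_(i <- ff_seq D' | i != j) (if ff_e x i != 0 then (2 * ff_f i)%N else 0%N)
   <= \sum_(i <- ff_seq D' | i != j) (2 * ff_f i)%N)%N.
  by apply: leq_sum => i _; case: ifP.
by rewrite -e2 -[leqRHS]add0n leq_add2r leqn0 muln_eq0 /= -leqn0 leqNgt fpos.
Qed.

Section Half.
Variables D D' : factor_family X.
Hypotheses (aD : ff_axioms D) (aD' : ff_axioms D').
Hypothesis eqD : forall x, ff_poly D x = ff_poly D' x.

Let agree (i : ff_index D) (j : ff_index D') :=
  `[< forall x, ff_unit D x -> ff_e x j = ff_e x i >].

Lemma ln_prod (I : eqType) (s : seq I) (F : I -> R) : (forall i, i \in s -> 0 < F i) ->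
  ln (\prod_(i <- s) F i) = \sum_(i <- s) ln (F i).
Proof.
elim: s => [|i s IH] pos; first by rewrite !big_nil ln1.
have posi := pos _ (mem_head _ _).
have poss j : j \in s -> 0 < F j by move=> js; apply: pos; rewrite inE js orbT.
rewrite !big_cons lnM ?posrE ?IH //.
by rewrite big_seq; apply: prodr_gt0 => j /poss.
Qed.

Lemma ln_ff_poly D1 x y t : ff_axioms D1 -> ff_unit D1 y ->
  (forall i : ff_index D1, i \in ff_seq D1 -> small_at (ff_a i) t) ->
  ln (reval (ff_poly D1 (mul x y)) t) =
  \sum_(i <- ff_seq D1) ((ff_e x i ^+ 2)%:~R * evenlog p (ff_a i) (ff_f i) t +
    (ff_e x i)%:~R * oddlog p (ff_a i) (ff_f i) t * (ff_e y i)%:~R).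
Proof.
move=> [_ fpos epm eM _] uy sm.
rewrite /ff_poly /reval rmorph_prod horner_prod ln_prod; last first.
  move=> i si; apply: trinomial_gt0; [exact: fpos|exact: (epm i si).1|exact: sm].
apply: eq_big_seq => i si; rewrite eM ?uy // -ln_trinomial //; first exact: (epm i si).1.
have := uy i si; case: ((epm i si).1 y) => ->; rewrite ?eqxx //; auto.
Qed.

(** [x] is fixed and y runs over [ff_unit D] in the logarithms at [mul x y]. A character separating
    [i0] shows that its class contains neither the trivial character nor another index of D. *)
Lemma odd_component (i0 : ff_index D) x t : i0 \in ff_seq D ->
  (forall i : ff_index D, i \in ff_seq D -> small_at (ff_a i) t) ->
  (forall j : ff_index D', j \in ff_seq D' -> small_at (ff_a j) t) ->
  (ff_e x i0)%:~R * oddlog p (ff_a i0) (ff_f i0) t =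
  \sum_(j <- ff_seq D' | agree i0 j)
     (ff_e x j)%:~R * oddlog p (ff_a j) (ff_f j) t.
Proof.
move=> si0 sm sm'.
have [uD fpos epm eM sep] := aD; have [uD' fpos' epm' eM' sep'] := aD'.
(* [None] stands for the trivial character and carries the even parts, which do not vary with y. *)
pose I := option (ff_index D + ff_index D')%type.
pose e (k : I) (y : X) : int := match k with
  | None => 1 | Some (inl i) => ff_e y i | Some (inr j) => ff_e y j end.
pose c (k : I) : R := match k with
  | None => \sum_(i <- ff_seq D) (ff_e x i ^+ 2)%:~R * evenlog p (ff_a i) (ff_f i) t
     - \sum_(i <- ff_seq D') (ff_e x i ^+ 2)%:~R * evenlog p (ff_a i) (ff_f i) t
  | Some (inl i) => (ff_e x i)%:~R * oddlog p (ff_a i) (ff_f i) t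
  | Some (inr j) => - ((ff_e x j)%:~R * oddlog p (ff_a j) (ff_f j) t) end.
pose s : seq I := None :: map (Some \o inl) (ff_seq D) ++ map (Some \o inr) (ff_seq D').
have sub := ff_unit_sub aD aD' eqD.
have unit1 : ff_unit D one by move=> i /epm[_ ->].
have unitM y z : ff_unit D y -> ff_unit D z -> ff_unit D (mul y z).
  by move=> uy uz i si; rewrite eM ?uz // mulf_neq0 ?uy ?uz.
have := @char_independence R X mul one (ff_unit D) I e (fun y => ff_e y i0) s c.
move=> /(_ (@intr_inj R) unit1 unitM (epm _ si0).2) indep.
have eI k : k \in s -> forall y z, ff_unit D y -> ff_unit D z -> e k (mul y z) = e k y * e k z.
  rewrite inE mem_cat => /or3P[/eqP->|/mapP[i si ->]|/mapP[j sj ->]] y z uy uz //=.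
  + by rewrite eM // uz.
  + by rewrite eM' //; exact: (sub _ uz).
have rel y : ff_unit D y -> \sum_(k <- s) c k * (e k y)%:~R = 0.
  move=> uy; rewrite /s big_cons big_cat !big_map /= mulr1.
  have := congr1 (fun q => ln (reval q t)) (eqD (mul x y)).
  rewrite /= !ln_ff_poly //; last exact: sub.
  rewrite !big_split /= => H.
  under [X in _ + (_ + X)]eq_bigr do rewrite mulNr.
  rewrite sumrN; move: H; move: (\sum_(i <- _) _) (\sum_(i <- _) _) => u v.
  move: (\sum_(i <- _) _) (\sum_(i <- _) _) => u' v'; lra.
have [y0 [y01 y0s]] := sep _ si0; move: (indep eI rel).
have uy0 : ff_unit D y0.
  by move=> i si; have [->|ni] := eqVneq i i0; rewrite ?y01 // y0s.
rewrite /s big_cons asboolF; last by move=> /(_ _ uy0); rewrite /= y01.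
rewrite big_cat !big_map /=.
rewrite (_ : \sum_(i <- ff_seq D | _) _ = (ff_e x i0)%:~R * oddlog p (ff_a i0) (ff_f i0) t).
  by rewrite sumrN => /eqP; rewrite subr_eq0 => /eqP.
rewrite big_mkcond (bigD1_seq i0) //= asboolT // big1_seq ?addr0 // => i /andP[ni si].
rewrite asboolF // => /(_ _ uy0); rewrite y01 y0s //.
Qed.

(** Some j agrees with i on units, since otherwise the odd part at i would vanish; separation in D'
    leaves only one. Letting t vary gives a and f, and cancelling the common odd part then gives the
    values at every x, ramified ones included. *)
Lemma match_half (i : ff_index D) : i \in ff_seq D -> ff_a i != 0 ->
  exists2 j : ff_index D', j \in ff_seq D' &
    [/\ ff_a j = ff_a i, ff_f j = ff_f i & forall x, ff_e x j = ff_e x i].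
Proof.
move=> si ai0.
have [uD fpos epm eM sep] := aD; have [uD' fpos' epm' eM' sep'] := aD'.
have [d d0 dsm] := small_delta R (map (@ff_a X D) (ff_seq D) ++ map (@ff_a X D') (ff_seq D')).
have sm t : 0 < t <= d -> forall i : ff_index D, i \in ff_seq D -> small_at (ff_a i) t.
  by move=> td k sk; apply: dsm td; rewrite mem_cat map_f.
have sm' t : 0 < t <= d -> forall j : ff_index D', j \in ff_seq D' -> small_at (ff_a j) t.
  by move=> td k sk; apply: dsm td; rewrite mem_cat (map_f (@ff_a X D')) ?orbT.
have dd : 0 < d <= d by rewrite d0 lexx.
have sub' := ff_unit_sub aD' aD (fun x => esym (eqD x)).
have [j sj agj] : exists2 j, j \in ff_seq D' & agree i j.
  apply: contrapT => nex.
  have := odd_component one si (sm _ dd) (sm' _ dd).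
  rewrite (epm _ si).2 mul1r big1_seq => [|j /andP[agj sj]]; last by case: nex; exists j.
  by apply/eqP; apply: oddlog_neq0; [exact: fpos|exact: (sm _ dd)|].
have single x t : 0 < t <= d -> (ff_e x i)%:~R * oddlog p (ff_a i) (ff_f i) t =
    (ff_e x j)%:~R * oddlog p (ff_a j) (ff_f j) t.
  move=> td; rewrite (odd_component x si (sm _ td) (sm' _ td)).
  rewrite big_mkcond (bigD1_seq j) //= agj big1_seq ?addr0 // => k /andP[nk sk].
  case: ifP => // agk.
  have [y [y1 ys]] := sep' _ sj.
  have uy : ff_unit D y.
    by apply: sub' => l sl; have [->|nl] := eqVneq l j; rewrite ?y1 // ys.
  move/asboolP: agj => /(_ _ uy); move/asboolP: agk => /(_ _ uy) <-.
  by rewrite y1 ys.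
have [ea ef] : ff_a j = ff_a i /\ ff_f j = ff_f i.
  apply: (@oddlog_inj R p p0 _ _ _ _ d) => //; [exact: fpos|exact: fpos'| |].
    by move=> t td; split; [exact: sm|exact: sm'].
  by move=> t td; have := single one t td; rewrite (epm _ si).2 (epm' _ sj).2 !mul1r.
exists j => //; split=> // x; have := single x d dd; rewrite ea ef => /(mulIf _) H.
apply/esym/(@intr_inj R)/H; apply: oddlog_neq0; [exact: fpos|exact: (sm _ dd)|exact: ai0].
Qed.

End Half.

(** When a = 0 the factor depends on the character value only through its square, so its sign is
    lost and the key forgets the character. *)
Definition ff_key D (i : ff_index D) : int * nat * (X -> int) :=
  (ff_a i, ff_f i, if ff_a i != 0 then (fun x => ff_e x i) else (fun=> 0)).

Lemma match_keys D D' : ff_axioms D -> ff_axioms D' ->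
  (forall x, ff_poly D x = ff_poly D' x) ->
  perm_eq (map (@ff_key D) (ff_seq D)) (map (@ff_key D') (ff_seq D')).
Proof.
move=> aD aD' eqD.
have [uD fpos epm _ sep] := aD; have [uD' fpos' epm' _ sep'] := aD'.
pose n0 (D1 : factor_family X) (i : ff_index D1) := ff_a i != 0.
pose nz (D1 : factor_family X) := [seq i <- ff_seq D1 | n0 D1 i].
pose zs (D1 : factor_family X) := [seq i <- ff_seq D1 | predC (n0 D1) i].
have pcat (D1 : factor_family X) : perm_eq (nz D1 ++ zs D1) (ff_seq D1).
  by apply/permPl; exact: perm_filterC.
(* Separation makes the keys with a nonzero pairwise distinct, so mutual inclusion will suffice for
   equality of multisets. *)
have unz (D1 : factor_family X) : ff_axioms D1 -> uniq (map (@ff_key D1) (nz D1)).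
  move=> [u1 _ _ _ sep1]; rewrite map_inj_in_uniq ?filter_uniq // => i j.
  rewrite !mem_filter => /andP[ni si] /andP[nj sj] [_ _]; rewrite -/(n0 D1 i) ni -/(n0 D1 j) nj.
  move=> e; apply/eqP/negPn/negP => nij; have [x [xi xs]] := sep1 _ si.
  have := congr1 (fun g => g x) e; rewrite xi xs //; by rewrite eq_sym.
have sub (D1 D2 : factor_family X) : ff_axioms D1 -> ff_axioms D2 ->
    (forall x, ff_poly D1 x = ff_poly D2 x) ->
    {subset map (@ff_key D1) (nz D1) <= map (@ff_key D2) (nz D2)}.
  move=> a1 a2 e12 _ /mapP[i +  ->]; rewrite mem_filter => /andP[ni si].
  have [j sj [ea ef ee]] := match_half a1 a2 e12 si ni.
  apply/mapP; exists j; first by rewrite mem_filter /n0 ea [X in X && _]ni.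
  rewrite /ff_key ea ef; congr (_, _, _); case: ifP => // _.
  by apply/funext => x; rewrite ee.
have pnz : perm_eq (map (@ff_key D) (nz D)) (map (@ff_key D') (nz D')).
  apply: uniq_perm; [exact: unz|exact: unz|] => k; apply/idP/idP; apply: sub => //.
pose G (k : int * nat * (X -> int)) := trinomial p 1 k.1.1 k.1.2.
have polyE (D1 : factor_family X) : ff_axioms D1 -> ff_poly D1 one =
    (\prod_(k <- map (@ff_key D1) (nz D1)) G k) *
    \prod_(f <- map (@ff_f X D1) (zs D1)) (1 + (p ^ f)%:Z *: 'X^(2 * f)).
  move=> [_ _ pm1 _ _]; rewrite /ff_poly -(perm_big _ (pcat D1)) big_cat !big_map /=.
  congr (_ * _); rewrite big_seq [RHS]big_seq; apply: eq_bigr => i; rewrite mem_filter.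
    by move=> /andP[_ /pm1[_ ->]].
  move=> /andP[/negbNE /eqP a0 /pm1[_ ->]].
  by rewrite /trinomial a0 mulr0 scale0r addr0 expr1n mul1r.
have fp (D1 : factor_family X) : ff_axioms D1 ->
    forall f, f \in map (@ff_f X D1) (zs D1) -> (0 < f)%N.
  by move=> [_ pos _ _ _] _ /mapP[i + ->]; rewrite mem_filter => /andP[_ /pos].
have pzs : perm_eq (map (@ff_f X D) (zs D)) (map (@ff_f X D') (zs D')).
  apply: (binomial_prod_perm p0); [exact: fp|exact: fp|].
  have := eqD one; rewrite !polyE // (perm_big _ pnz); apply: mulfI.
  rewrite big_map prodf_seq_neq0; apply/allP => j; rewrite mem_filter => /andP[_ sj].
  rewrite -size_poly_eq0 size_trinomial //; first exact: fpos'.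
  by constructor 2.
have zkey (D1 : factor_family X) : map (@ff_key D1) (zs D1) =
   map (fun f => (0, f, fun=> 0) : int * nat * (X -> int)) (map (@ff_f X D1) (zs D1)).
  rewrite -map_comp; apply/eq_in_map => i; rewrite mem_filter => /andP[/negbNE /eqP a0 _].
  by rewrite /ff_key a0 eqxx.
apply: perm_trans (perm_map _ (pcat D')).
rewrite perm_sym; apply: perm_trans (perm_map _ (pcat D)).
by rewrite !map_cat perm_sym perm_cat // !zkey perm_map.
Qed.

End Matching.

Section PrimeFamily.
Variables (K : fieldExtType rat) (iota : {rmorphism K -> algC}) (E : weierstrass K).
Variables (X : Type) (mul : X -> X -> X) (one : X) (h : X -> quad_char iota).
Variable p : nat.
Hypotheses (p_pr : prime p) (p_odd : odd p).
Hypothesis hM : forall x y, h (mul x y) = qmul (h x) (h y).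
Hypothesis h1 : forall g, h one g = 1.
Hypothesis h_surj : forall chi, exists x, h x = chi.

(** [h] will be the identity for K and psi for K'; its surjectivity brings separating characters
    back to [X]. *)
Definition prime_family : factor_family X :=
  @FactorFamily X (set K) (fset_set (primes_above K p)) (ap E) (inertia_degree p)
    (fun x P => char_at (h x) P).

Lemma mem_primes_above (P : set K) :
  (P \in (fset_set (primes_above K p) : seq (set K))) <-> primes_above K p P.
Proof.
by rewrite in_fset_set; [split=> [/set_mem//|/mem_set]|exact: finite_primes_above].
Qed.

Lemma prime_family_axioms : ff_axioms mul one prime_family.
Proof.
split=> /=.
- exact: fset_uniq.
- by move=> P /mem_primes_above PP; have [/andP[]] := norm_ideal_expE p_pr PP.
- move=> P /mem_primes_above PP; split=> [x|]; first exact: char_at_pm.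
  exact: (char_at_triv p_pr p_odd PP).
- by move=> P x y /mem_primes_above PP e0; rewrite hM (char_atM p_pr p_odd PP).
- move=> P /mem_primes_above PP; have [chi [cP cQ]] := char_separate iota p_pr p_odd PP.
  have [x hx] := h_surj chi; exists x; rewrite hx; split=> // Q /mem_primes_above PQ /eqP.
  exact: cQ.
Qed.

Lemma prime_family_poly x : (forall P, primes_above K p P -> good_reduction E P) ->
  ff_poly p prime_family x = euler_factor E (h x) p.
Proof.
move=> good; rewrite /ff_poly /euler_factor; apply: eq_big_seq => P /mem_primes_above PP.
by rewrite /twisted_local_factor asboolT //; exact: good.
Qed.

End PrimeFamily.

Lemma primes_above_inj (K : fieldExtType rat) (p q : nat) (P : set K) :
  prime p -> prime q -> primes_above K p P -> primes_above K q P -> p = q.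
Proof.
move=> p_pr q_pr PP Pq; have := (primeI_int p_pr PP q).1 (primeIp Pq).
by rewrite dvdzE /= dvdn_prime2 // => /eqP.
Qed.

Unset Implicit Arguments.

Theorem theorem3p1 (R : realType) (K K' : fieldExtType rat)
    (iota : {rmorphism K -> algC}) (iota' : {rmorphism K' -> algC})
    (E : weierstrass K) (E' : weierstrass K')
    (hE : elliptic E) (hE' : elliptic E')
    (psi : quad_char iota -> quad_char iota')
    (psi_bij : bijective psi)
    (psi_mul : forall c1 c2 : quad_char iota,
       psi (qmul c1 c2) = qmul (psi c1) (psi c2))
    (hL : forall (chi : quad_char iota) (s : R[i]),
       3 / 2 < complex.Re s -> Lseries E chi s = Lseries E' (psi chi) s) :
  let S := good_rational_primes E E' in
  exists phi : set K -> set K',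
    [/\ set_bij (primes_over K S) (primes_over K' S) phi,
        forall P, primes_over K S P -> norm_ideal (phi P) = norm_ideal P,
        forall P, primes_over K S P -> ap E P = ap E' (phi P)
      & forall (chi : quad_char iota) P,
          primes_over K S P -> ap E P != 0 ->
          char_at chi P = char_at (psi chi) (phi P)].
Proof.
move=> S.
(* The square of any character serves as the trivial one. *)
have [c0 _] := quad_char_exists iota (oner_neq0 K).
have [psi' _ psiK] := psi_bij.
(* Matching proceeds one rational prime at a time; a constant map outside [S] lets [choice] select
   all the bijections. *)
have match_p (p : nat) : exists g : set K -> set K', S p ->
  [/\ forall P, primes_above K p P -> primes_above K' p (g P) /\
        ff_key (D := prime_family E' psi p) (g P) = ff_key (D := prime_family E id p) P,
      forall P Q, primes_above K p P -> primes_above K p Q -> g P = g Q -> P = Q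
    & forall Q, primes_above K' p Q -> exists2 P, primes_above K p P & g P = Q].
  have [Sp|nSp] := pselect (S p); last by exists (fun=> set0).
  have [[p_pr p_odd] _ _ gE gE'] := Sp.
  have aD : ff_axioms (@qmul K iota) (qmul c0 c0) (prime_family E id p).
    apply: prime_family_axioms => //; last by move=> chi; exists chi.
    by move=> g; rewrite /= -expr2 qc_sqr.
  have aD' : ff_axioms (@qmul K iota) (qmul c0 c0) (prime_family E' psi p).
    apply: prime_family_axioms => //; last by move=> chi; exists (psi' chi).
    by move=> g; rewrite psi_mul /= -expr2 qc_sqr.
  have eqD chi : ff_poly p (prime_family E id p) chi = ff_poly p (prime_family E' psi p) chi.
    by rewrite !prime_family_poly //; apply: euler_factor_eq p_pr; exact: hL.
  have [g [gP gi gs]] := perm_map_bij set0 (fset_uniq _) (fset_uniq _)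
    (match_keys R (prime_gt0 p_pr) aD aD' eqD).
  exists g => _; split.
  - move=> P /(mem_primes_above p_pr) /gP[gB gk]; split=> //.
    exact/(mem_primes_above p_pr).
  - by move=> P Q /(mem_primes_above p_pr) PA /(mem_primes_above p_pr) QA; exact: gi.
  - move=> Q /(mem_primes_above p_pr) /gs[P PA gPQ]; exists P => //.
    exact/(mem_primes_above p_pr).
have [G GP] := choice match_p.
(* P determines the rational prime below it, so the maps [G p] glue to a single [phi]. *)
pose below (P : set K) := xget 0%N [set p | S p /\ primes_above K p P].
have belowE p P : S p -> primes_above K p P -> below P = p.
  move=> Sp PP; apply: xget_subset1 => // q q' [Sq Pq] [Sq' Pq'].
  by apply: (primes_above_inj _ _ Pq Pq'); [have [[]] := Sq|have [[]] := Sq'].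
pose phi P := G (below P) P.
have phiE p P : S p -> primes_above K p P -> phi P = G p P.
  by move=> Sp PP; rewrite /phi (belowE p).
have keyE P : primes_over K S P -> exists p, [/\ S p, primes_above K p P,
   primes_above K' p (phi P) &
   ff_key (D := prime_family E' psi p) (phi P) = ff_key (D := prime_family E id p) P].
  move=> [p Sp PP]; have [gP _ _] := GP p Sp; have [PQ kQ] := gP P PP.
  by exists p; rewrite (phiE p).
exists phi; split.
- split.
  + by move=> P /keyE[p [Sp _ PQ _]]; exists p.
  + move=> P Q /set_mem /keyE[p [Sp PP PP' _]] /set_mem /keyE[q [Sq PQ PQ' _]] eq_phi.
    have [[p_pr _] _ _ _ _] := Sp; have [[q_pr _] _ _ _ _] := Sq.
    (* The common image lies above both p and q, which forces p = q and reduces to injectivity of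
       [G p]. *)
    rewrite -eq_phi in PQ'; have epq := primes_above_inj p_pr q_pr PP' PQ'.
    subst q; have [_ gi _] := GP p Sp; apply: gi => //.
    by rewrite -!(phiE p).
  + move=> Q [p Sp PQ]; have [_ _ gs] := GP p Sp; have [P PP gPQ] := gs Q PQ.
    by exists P; [exists p|rewrite (phiE p)].
- move=> P /keyE[p [Sp PP PQ [_ ef _]]]; have [[p_pr _] _ _ _ _] := Sp.
  by rewrite (norm_ideal_expE p_pr PP).2 (norm_ideal_expE p_pr PQ).2; congr (_ ^ _)%N.
- by move=> P /keyE[p [_ _ _ [ea _ _]]]; exact: esym ea.
- move=> chi P /keyE[p [_ _ _ [ea _ ee]]] a0; move: ee; rewrite /= ea a0 /= => ee.
  exact: (esym (congr1 (fun f => f chi) ee)).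
Qed.
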